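(* Let $\mathcal{G}=(\mathcal{V},\mathcal{E},A)$ be a weighted digraph with $n$ nodes and graph Laplacian $L$, and let $f_1,\dots,f_n:\mathbb{R}\to\mathbb{R}$ be sign preserving, Lebesgue measurable and locally essentially bounded. Put $f(y)=[f_1(y_1),\dots,f_n(y_n)]^\top$ for $y\in\mathbb{R}^n$ and $h(x)=f(-Lx)$ for $x\in\mathbb{R}^n$, and consider the differential inclusion $$\dot x(t)\in\mathcal{F}[h](x(t)),$$ where it is assumed that for every initial condition all its solutions are complete. Suppose that one of the following conditions holds: (i) $\mathcal{I}_c\cap\mathcal{I}_r\neq\emptyset$; (ii) $|\mathcal{I}_r|=1$; (iii) $|\mathcal{I}_r|=2$, and for each $i\in\mathcal{I}_r$ the one-sided limits $f_i(0^-)$ and $f_i(0^+)$ exist and satisfy $f_i(0^-)=-f_i(0^+)$. Then, for any initial condition $x(0)\in\mathbb{R}^n$, every trajectory $x(\cdot)$ of the differential inclusion achieves consensus asymptotically, i.e. there is a constant $\eta\in\mathbb{R}$ (depending on the trajectory) with $\lim_{t\to\infty}x(t)=\eta\mathbf{1}$. Furthermore, $x(t)\in[\min_i x_i(0),\max_i x_i(0)]^n$ for all $t\ge 0$.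
   Context: Graphs. $\mathcal{G}=(\mathcal{V},\mathcal{E},A)$ is a weighted digraph with node set $\mathcal{V}=\{v_1,\dots,v_n\}$, edge set $\mathcal{E}\subseteq\mathcal{V}\times\mathcal{V}$, and weighted adjacency matrix $A=[a_{ij}]$ with nonnegative entries; $e_{ij}=(v_i,v_j)$ denotes the edge from $v_i$ to $v_j$; $a_{ij}>0$ if and only if $e_{ji}\in\mathcal{E}$, and $a_{ii}=0$ for all $i$. The graph Laplacian is $L=\Delta-A$, where $\Delta$ is the diagonal matrix with $\Delta_{ii}=\sum_{j=1}^n a_{ij}$; thus $(-Lx)_i=\sum_{j=1}^n a_{ij}(x_j-x_i)$. A node $v$ is a root of $\mathcal{G}$ if there is a directed path (following edge orientations) from $v$ to every other node. $\mathbf{1}$ is the all-ones vector in $\mathbb{R}^n$. Index sets. $\mathcal{I}=\{1,\dots,n\}$, $\mathcal{I}_r=\{i\in\mathcal{I}: v_i\text{ is a root of }\mathcal{G}\}$, $\mathcal{I}_c=\{i\in\mathcal{I}: f_i\text{ is continuous at }0\}$. Filippov map. For $F:\mathbb{R}^m\to\mathbb{R}^m$, $\mathcal{F}[F](x)=\bigcap_{\delta>0}\bigcap_{\mu(S)=0}\overline{\mathrm{co}}\{F(B(x,\delta)\setminus S)\}$, where $B(x,\delta)$ is the open ball of radius $\delta$ about $x$, $\mu$ is Lebesgue measure and $\overline{\mathrm{co}}$ is the closed convex hull. A map is locally essentially bounded if its restriction to every compact set is bounded almost everywhere by a constant. Sign preserving. $\varphi:\mathbb{R}\to\mathbb{R}$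 is sign preserving if $\varphi(0)=0$ and for each $y\in\mathbb{R}\setminus\{0\}$ both $y\varphi(y)>0$ and $\min\, y\,\mathcal{F}[\varphi](y)>0$, where $y\,\mathcal{F}[\varphi](y)=\{yw: w\in\mathcal{F}[\varphi](y)\}$. Solutions. A trajectory (Filippov solution) is an absolutely continuous function $x(\cdot)$ satisfying the differential inclusion for almost every $t$. Completeness means that solutions are defined for all $t\ge 0$. *)

(* Defs.v *)
From HB Require Import structures.
From mathcomp Require Import all_boot all_order all_algebra.
From mathcomp Require Import all_classical all_reals all_analysis.

Set Implicit Arguments.
Unset Strict Implicit.
Unset Printing Implicit Defensive.

Import Order.TTheory GRing.Theory Num.Theory.
Import numFieldNormedType.Exports.

Local Open Scope classical_set_scope.
Local Open Scope ring_scope.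

(* An edge [wd_edge j i] goes from [j] to [i] and carries the weight
   [wd_adj i j]. *)
Record wdigraph (R : realType) (n : nat) := WDigraph {
  wd_adj : 'M[R]_n;
  wd_edge : rel 'I_n;
  wd_adj_ge0 : forall i j, 0 <= wd_adj i j;
  wd_adj_gt0 : forall i j, (0 < wd_adj i j) = wd_edge j i;
  wd_adj_diag : forall i, wd_adj i i = 0 }.

Definition laplacian (R : realType) (n : nat) (G : wdigraph R n) : 'M[R]_n :=
  diag_mx (\row_i \sum_j wd_adj G i j) - wd_adj G.

Definition is_root (R : realType) (n : nat) (G : wdigraph R n) (i : 'I_n) :=
  [forall j, connect (wd_edge G) i j].

Definition root_nodes (R : realType) (n : nat) (G : wdigraph R n) : {set 'I_n} :=
  [set i | is_root G i]%SET.

Definition cont_nodes (R : realType) (n : nat) (f : 'I_n -> R -> R) : {set 'I_n} :=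
  [set i | `[< {for 0, continuous (f i)} >]]%SET.

Definition closed_convex_hull (R : realType) (V : normedModType R)
    (A : set V) : set V :=
  \bigcap_(C in [set C : set V | [/\ closed C, convex_set C & A `<=` C]]) C.

(* The notion of ball and the ideal of null sets are parameters, to be
   instantiated on R and on R^m below. *)
Definition filippov_gen (R : realType) (V : normedModType R)
    (B : V -> R -> set V) (null : set V -> Prop) (F : V -> V) (x : V) : set V :=
  \bigcap_(d in [set d : R | 0 < d]) \bigcap_(S in [set S | null S])
    closed_convex_hull (F @` (B x d `\` S)).

Definition filippov1 (R : realType) (phi : R -> R) : R -> set R :=
  filippov_gen (fun y d => ball y d)
    (fun S => (@lebesgue_measure R).-negligible S) phi.

(* The norm of 'cV[R]_m in the library is the sup norm, hence an explicit
   Euclidean ball. *)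
Definition eball (R : realType) (m : nat) (x : 'cV[R]_m) (d : R) :
    set 'cV[R]_m :=
  [set y | Num.sqrt (\sum_i (x i 0 - y i 0) ^+ 2) < d].

Definition box (R : realType) (m : nat) (ab : 'cV[R]_m * 'cV[R]_m) :
    set 'cV[R]_m :=
  [set y | forall i, ab.1 i 0 <= y i 0 <= ab.2 i 0].

Definition box_vol (R : realType) (m : nat) (ab : 'cV[R]_m * 'cV[R]_m) : R :=
  \prod_i (ab.2 i 0 - ab.1 i 0).

(* Lebesgue outer measure of R^m: infimum of the total volume of the countable
   (possibly finite, whence the index set [D]) covers by boxes. *)
Definition lebesgue_outer (R : realType) (m : nat) (S : set 'cV[R]_m) : \bar R :=
  ereal_inf [set v : \bar R | exists (D : set nat)
      (c : nat -> 'cV[R]_m * 'cV[R]_m),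
    [/\ forall k i, (c k).1 i 0 <= (c k).2 i 0,
        S `<=` \bigcup_(k in D) box (c k) &
        v = (\esum_(k in D) (box_vol (c k))%:E)%E]].

Definition filippov (R : realType) (m : nat) (F : 'cV[R]_m -> 'cV[R]_m) :
    'cV[R]_m -> set 'cV[R]_m :=
  filippov_gen (@eball R m) (fun S => lebesgue_outer S = 0%E) F.

(* Measurability with respect to the Lebesgue (not merely Borel) sigma-algebra,
   the domain of [completed_lebesgue_measure]. *)
Definition lebesgue_measurable (R : realType) (phi : R -> R) : Prop :=
  measurable_fun
    [set: caratheodory_type (wlength (@idfun R))^*%mu] (phi : _ -> R).

Definition locally_ess_bounded (R : realType) (phi : R -> R) : Prop :=
  forall K : set R, compact K -> exists M : R,
    {ae lebesgue_measure, forall y, K y -> `|phi y| <= M}.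

Definition sign_preserving (R : realType) (phi : R -> R) : Prop :=
  phi 0 = 0 /\
  forall y, y != 0 -> 0 < y * phi y /\
    exists m, [/\ [set y * w | w in filippov1 phi y] m,
                  lbound [set y * w | w in filippov1 phi y] m & 0 < m].

Definition abs_continuous_on (R : realType) (V : normedModType R)
    (x : R -> V) (s t : R) : Prop :=
  forall e : R, 0 < e -> exists2 d : R, 0 < d &
    forall (k : nat) (a b : 'I_k -> R),
      (forall i, [/\ s <= a i, a i <= b i & b i <= t]) ->
      trivIset setT (fun i => `]a i, b i[%classic) ->
      \sum_i (b i - a i) < d -> \sum_i `|x (b i) - x (a i)| < e.

(* Solution on [0, T[; the values of [x] outside [0, T[ are irrelevant.
   Absolute continuity is required on compact subintervals. *)
Definition is_solution (R : realType) (n : nat) (G : 'cV[R]_n -> set 'cV[R]_n)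
    (T : \bar R) (x : R -> 'cV[R]_n) : Prop :=
  (forall t : R, 0 <= t -> (t%:E < T)%E -> abs_continuous_on x 0 t) /\
  {ae lebesgue_measure, forall t : R, 0 <= t -> (t%:E < T)%E ->
    derivable x t 1 /\ G (x t) ('D_1 x t)}.

Definition is_maximal_solution (R : realType) (n : nat)
    (G : 'cV[R]_n -> set 'cV[R]_n) (T : \bar R) (x : R -> 'cV[R]_n) : Prop :=
  [/\ (0 < T)%E, is_solution G T x &
      forall (T' : \bar R) (y : R -> 'cV[R]_n), (T < T')%E ->
        is_solution G T' y ->
        ~ (forall t : R, 0 <= t -> (t%:E < T)%E -> y t = x t)].

Definition complete_inclusion (R : realType) (n : nat)
    (G : 'cV[R]_n -> set 'cV[R]_n) : Prop :=
  forall (T : \bar R) (x : R -> 'cV[R]_n),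
    is_maximal_solution G T x -> T = +oo%E.

Definition comp_map (R : realType) (n : nat) (f : 'I_n -> R -> R)
    (y : 'cV[R]_n) : 'cV[R]_n := \col_i f i (y i 0).

Definition consensus_field (R : realType) (n : nat) (G : wdigraph R n)
    (f : 'I_n -> R -> R) (x : 'cV[R]_n) : 'cV[R]_n :=
  comp_map f (- (laplacian G *m x)).

(* Main.v *)
Require Import Defs.
From HB Require Import structures.
From mathcomp Require Import all_boot all_order all_algebra.
From mathcomp Require Import all_classical all_reals all_analysis.
From mathcomp Require Import measurable_realfun lra ring.

(** Why the theorem holds.  Write [y_i(x)] for the disagreement
    [sum_j a_ij (x_j - x_i)], the [i]-th entry of [- L x], so that the field is
    [h_i(x) = f_i (y_i(x))].  The argument has two halves: the largest
    coordinate of a solution never increases (and the smallest never decreases),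
    and a cluster point of a solution can only be a consensus point.

    The Filippov map is used only through closed half-spaces: a linear
    inequality satisfied by [h] near [x], off a null set, passes to every
    velocity [w] in [F[h](x)] ([filippov_halfspace]).  Properties of [f_i] that
    hold almost everywhere on the line are transferred to [h_i] because the
    preimage of a null set under a nonzero linear form is null
    ([lebesgue_outer_preimage]); when the form [y_i] vanishes identically,
    [h_i] is identically [f_i 0 = 0].  In this way sign preservation becomes a
    uniform push ([velocity_push]): near a value [y_i <> 0], the velocity [w_i]
    has the sign of [y_i] and is bounded away from [0].

    For monotonicity, let [i] carry the maximum at time [t].  Coordinates that
    coincide have the same derivative outside a countable set of times
    ([coincident_derivatives]), so all maximizers share one velocity.  If a
    maximizer has [y_k < 0], that velocity is negative.  Otherwise every
    maximizer has [y_k = 0], so its in-neighbours are maximizers too, hence all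
    roots are maximizers; then the roots agree, and each of the three
    hypotheses on them forces their common velocity to be [0] ([root_at_rest]).
    With two roots [r] and [s] this is because the velocities of the pair lie on
    the segment between [(p, - q)] and [(- p, q)], where [p] and [q] are the
    right limits of [f_r] and [f_s] at [0], and this segment meets the diagonal
    only at the origin ([velocity_two_roots]).  An absolutely continuous
    function whose increments around almost every time are nearly nonpositive
    is nonincreasing ([abs_continuous_nonincreasing]); this gives the invariance
    of the box.  Minima are treated as maxima of [b *: x] with [b = -1].

    For convergence, the solution is bounded, hence Lipschitz, and has a cluster
    point [p].  Were a maximizer [i] of [p] to have [y_i(p) <> 0], then during a
    fixed time before each late visit near [p] the coordinate [i] would have
    decreased at a uniform rate, so the maximum would earlier have exceeded its
    limit ([cluster_extremum_balanced]).  So all maximizers of [p] are balanced,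
    which makes every root a maximizer; likewise every root is a minimizer, and
    [p] is a consensus point.  Monotonicity of the extreme coordinates turns one
    visit near [p] into convergence ([solution_consensus]). *)

Set Implicit Arguments.
Unset Strict Implicit.
Unset Printing Implicit Defensive.

Import Order.TTheory GRing.Theory Num.Theory.
Import numFieldNormedType.Exports.

Local Open Scope classical_set_scope.
Local Open Scope ring_scope.

(** * Null sets of the line and coordinates *)

Section Preliminaries.
Context {R : realType}.

Lemma lebesgue_negligibleS (A B : set R) : A `<=` B ->
  (@lebesgue_measure R).-negligible B -> (@lebesgue_measure R).-negligible A.
Proof.
by move=> AB [N [mN N0 BN]]; exists N; split => //; exact: subset_trans BN.
Qed.

Lemma countable_negligible (A : set R) :
  countable A -> (@lebesgue_measure R).-negligible A.
Proof.
move=> cA; exists A; split => //; last exact: countable_lebesgue_measure0.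
by apply: countable_measurable => // t; exact: measurable_set1.
Qed.

(** The filter of almost-everywhere properties of [lebesgue_measure] lives on the
    generated sigma-algebra over [R], where its filter instance is not inferred;
    these three lemmas supply it once. *)
Lemma lebesgue_aeS (P Q : R -> Prop) : (forall t, P t -> Q t) ->
  {ae lebesgue_measure, forall t, P t} -> {ae lebesgue_measure, forall t, Q t}.
Proof. exact: (@filterS _ _ (ae_filter_ringOfSetsType lebesgue_measure)). Qed.

Lemma lebesgue_aeI (P Q : R -> Prop) :
  {ae lebesgue_measure, forall t, P t} -> {ae lebesgue_measure, forall t, Q t} ->
  {ae lebesgue_measure, forall t, P t /\ Q t}.
Proof. exact: (@filterI _ _ (ae_filter_ringOfSetsType lebesgue_measure)). Qed.

Lemma lebesgue_ae_forall (I : finType) (P : I -> R -> Prop) :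
  (forall i, {ae lebesgue_measure, forall t, P i t}) ->
  {ae lebesgue_measure, forall t i, P i t}.
Proof.
exact: (@filter_forall _ _ (fun i => P i) _ (ae_filter_ringOfSetsType lebesgue_measure)).
Qed.

Lemma ler_coord n (x : 'cV[R]_n) i : `|x i 0| <= `|x|.
Proof. by rewrite [leRHS]/Num.norm /= mx_normrE; exact: (le_bigmax _ _ (i, 0)). Qed.

End Preliminaries.

(** * Monotonicity of absolutely continuous functions *)

Section AC.
Context {R : realType}.
Implicit Types (g : R -> R) (U : set R).

(** Finite families of successive intervals, listed from right to left so that a
    new interval is added at the head. *)
Fixpoint chain_in U (a t : R) (s : seq (R * R)) : Prop :=
  if s is (u, v) :: s' then
    [/\ u <= v, v <= t, `]u, v[ `<=` U & chain_in U a u s']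
  else a <= t.

Lemma chain_in_widen U a t t' s : t <= t' -> chain_in U a t s -> chain_in U a t' s.
Proof.
case: s => [|[u v] s] /= tt' H; first exact: le_trans tt'.
by case: H => ? ? ? ?; split => //; exact: le_trans tt'.
Qed.

Lemma chain_in_le U a t s : chain_in U a t s -> a <= t.
Proof.
elim: s t => [|[u v] s IH] t //= [uv vt _ /IH au].
by rewrite (le_trans au)// (le_trans uv).
Qed.

Lemma chain_in_nth U a t s i : chain_in U a t s -> (i < size s)%N ->
  let p := nth (a, a) s i in [/\ a <= p.1, p.1 <= p.2 & p.2 <= t].
Proof.
elim: s t i => [|[u v] s IH] t i //= [uv vt _ H].
case: i => [|i] /= si; first by split => //; exact: chain_in_le H.
have [? ? vu] := IH u i H si; split => //.
by rewrite (le_trans vu)// (le_trans uv).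
Qed.

Lemma chain_in_disjoint U a t s i j : chain_in U a t s -> (i < j < size s)%N ->
  (nth (a, a) s j).2 <= (nth (a, a) s i).1.
Proof.
elim: s t i j => [|[u v] s IH] t i j /=; first by rewrite andbF.
case=> uv vt _ H; case: i j => [|i] [|j] //= ij.
  by have [] := chain_in_nth H ij.
exact: IH H ij.
Qed.

Lemma chain_in_measure U a t s : open U -> chain_in U a t s ->
  ((\sum_(p <- s) (p.2 - p.1))%:E <= lebesgue_measure (U `&` `]-oo, t[))%E.
Proof.
move=> oU; elim: s t => [|[u v] s IH] t /=; first by rewrite big_nil measure_ge0.
case=> uv vt uvU /IH {}IH; rewrite big_cons EFinD.
have mU : measurable U by exact: open_measurable.
have muv : lebesgue_measure (`]u, v[ : set R) = (v - u)%:E.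
  rewrite lebesgue_measure_itv /= lte_fin; case: ltP => // vu.
  by have -> : u = v by [apply/le_anti; rewrite uv vu]; rewrite subrr.
rewrite -[(v - u)%:E]muv.
apply: (@le_trans _ _
  (lebesgue_measure (`]u, v[%classic `|` (U `&` `]-oo, u[%classic)))).
  rewrite measureU //; first exact: leeD.
  - exact: measurableI.
  - by apply/seteqP; split => // z [] /=; rewrite !in_itv/= => /andP[? _] [_ ?]; lra.
apply: le_measure; rewrite ?inE.
- by apply: measurableU => //; exact: measurableI.
- exact: measurableI.
- move=> z [zuv|[Uz]].
    by split; [exact: uvU|move: zuv; rewrite /= !in_itv /=; lra].
  by rewrite /= !in_itv /= => zu; split => //; lra.
Qed.

(** Successive intervals are pairwise disjoint, so their total length is at most
    the measure of the open set [U] that contains them.  Hence absolute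
    continuity controls the total increment of [g] over such a family by the
    measure of [U] alone. *)
Lemma abs_continuous_chain (g : R -> R) (a b : R) : abs_continuous_on g a b ->
  forall e, 0 < e -> exists2 d, 0 < d & forall U, open U ->
    (lebesgue_measure U < d%:E)%E -> forall s, chain_in U a b s ->
    \sum_(p <- s) (g p.2 - g p.1) < e.
Proof.
move=> ac e e0; have [d d0 H] := ac e e0; exists d => // U oU Ud s sU.
have HH := chain_in_nth sU.
apply: (@le_lt_trans _ _
  (\sum_(i < size s) `|g (nth (a, a) s i).2 - g (nth (a, a) s i).1|)).
  rewrite (big_nth (a, a)) big_mkord; apply: ler_sum => i _; exact: ler_norm.
apply: H.
- by move=> i; exact: HH.
- apply/trivIsetP => i j _ _ ij.
  wlog lij : i j ij / (i < j)%N.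
    move=> W; have [/W->//|ji|/ord_inj/eqP] := ltngtP i j; last by rewrite (negbTE ij).
    by rewrite setIC W // eq_sym.
  have := chain_in_disjoint sU (i := i) (j := j); rewrite lij ltn_ord => /(_ isT) ji.
  by apply/seteqP; split => // z [] /=; rewrite !in_itv /= => *; lra.
- rewrite -lte_fin; apply: le_lt_trans Ud.
  have := chain_in_measure oU sU; rewrite (big_nth (a, a)) big_mkord => /le_trans; apply.
  apply: le_measure; rewrite ?inE; last by move=> ? [].
  - by apply: measurableI => //; exact: open_measurable.
  - exact: open_measurable.
Qed.

(** A Cousin (gauge) argument.  The exceptional null set is enclosed in an open set
    [U] of measure below [d].  Sweeping from [a] to the right by short intervals
    tagged at points of [[a, b]], an interval tagged at a good point contributes at
    most [e1] times its length, and one tagged at an exceptional point lies in [U];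
    the latter together contribute at most [e / 2] by absolute continuity.

    The hypothesis is about increments over intervals around [t], not about a
    derivative, because it is applied to a maximum of finitely many functions,
    which need not be differentiable. *)
Lemma abs_continuous_nonincreasing g (a b : R) : a <= b -> abs_continuous_on g a b ->
  {ae lebesgue_measure, forall t, a <= t <= b -> forall e, 0 < e ->
     exists2 d, 0 < d & forall u v, a <= u -> u <= t -> t <= v -> v <= b ->
       v - u < d -> g v - g u <= e * (v - u)} ->
  g b <= g a.
Proof.
move=> ab ac [N [mN N0 Nsub]].
apply/ler_addgt0Pr => e e0.
pose e1 := e / 2 / (b - a + 1).
have ba1 : 0 < b - a + 1 by lra.
have e10 : 0 < e1 by rewrite !divr_gt0.
have e20 : 0 < e / 2 by lra.
have [d d0 Hd] := abs_continuous_chain ac e20.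
have [|U [oU NU Ud]] := @lebesgue_regularity_outer R N d mN _ d0.
  by rewrite [ltLHS]N0 ltry.
have {}Ud : (lebesgue_measure U < d%:E)%E.
  have -> : lebesgue_measure U =
      (lebesgue_measure (U `\` N) + lebesgue_measure (U `&` N))%E.
    by apply: measureDI => //; exact: open_measurable.
  have -> : lebesgue_measure (U `&` N) = 0%E.
    apply/eqP; rewrite -measure_le0 -[leRHS]N0; apply: le_measure; rewrite ?inE //.
    by apply: measurableI => //; exact: open_measurable.
  by rewrite adde0.
pose P t := exists2 s, chain_in U a t s &
  g t - g a <= e1 * (t - a) + \sum_(p <- s) (g p.2 - g p.1).
(* Extending a partition by one interval tagged at [t]. *)
have step t : a <= t <= b -> exists2 c, 0 < c &
    forall u v, a <= u -> u <= t -> t <= v -> v <= b -> v - u < c -> P u -> P v.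
  move=> tab; have [Nt|nNt] := pselect (N t).
    have : nbhs t U by apply: open_nbhs_nbhs; split => //; exact: NU.
    move=> /nbhs_ballP[c /= c0 cU].
    exists c => // u v au ut tv vb vuc [s sU Ps].
    exists ((u, v) :: s).
      split => //; first exact: le_trans tv.
      by move=> z /=; rewrite in_itv /= => zuv; apply: cU; rewrite /ball/= ltr_norml; lra.
    rewrite big_cons /=.
    have : e1 * (u - a) <= e1 * (v - a) by rewrite ler_pM2l//; lra.
    by lra.
  have [|c c0 Hc] := _ : exists2 c, 0 < c &
      forall u v, a <= u -> u <= t -> t <= v -> v <= b -> v - u < c ->
      g v - g u <= e1 * (v - u).
    apply: contrapT => H; apply: nNt; apply: Nsub => /= W; apply: H; exact: W.
  exists c => // u v au ut tv vb vuc [s sU Ps].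
  exists s; first by apply: chain_in_widen sU; exact: le_trans tv.
  have := Hc u v au ut tv vb vuc.
  by rewrite !mulrBr; lra.
suff [s sU Ps] : P b.
  have := Hd _ oU Ud _ sU.
  have : e1 * (b - a) <= e / 2.
    by rewrite /e1 mulrAC ler_pdivrMr// ler_pM2l//; lra.
  by lra.
(* Supremum argument: a step tagged at [sup E] would go beyond [sup E], unless
   [sup E = b]. *)
pose E := [set t | a <= t <= b /\ P t].
have Ea : E a.
  split; first by rewrite lexx.
  by exists [::] => //=; rewrite big_nil; lra.
have hE : has_sup E by split; [exists a|exists b => t [/andP[]]].
have sab : a <= sup E <= b.
  by rewrite ub_le_sup//=; [apply: ge_sup => [|t [/andP[]]//]; exists a|case: hE].
have [c c0 Hc] := step _ sab.
have [t Et tc] := sup_adherent (divr_gt0 c0 (ltr0n _ 2)) hE.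
have ts : t <= sup E by apply: ub_le_sup => //; case: hE.
pose v := Num.min (sup E + c / 3) b.
have [/andP[at_ tb] Pt] := Et.
have vle : v <= sup E + c / 3 by rewrite ge_min lexx.
have vb : v <= b by rewrite ge_min lexx orbT.
have sv : sup E <= v by rewrite le_min; lra.
have Pv : P v by apply: (Hc t) => //; lra.
suff <- : v = b by [].
apply/le_anti; rewrite vb /= leNgt; apply/negP => vltb.
have vE : v = sup E + c / 3.
  by move: vltb; rewrite /v minElt; case: ifP => // _; rewrite ltxx.
have : v <= sup E.
  by apply: ub_le_sup; [case: hE|split => //; rewrite vb andbT; lra].
by lra.
Qed.
End AC.

(** * Derivatives along absolutely continuous curves *)

Section Analysis.
Context {R : realType}.

Lemma finite_radius (I : finType) (Q : I -> R -> Prop) :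
  (forall i d d', d' <= d -> Q i d -> Q i d') ->
  (forall i, exists2 d, 0 < d & Q i d) -> exists2 d, 0 < d & forall i, Q i d.
Proof.
move=> Qle /(_ _)/cid2 H; pose r i := sval (H i).
exists (\big[Num.min/1]_i r i).
  by apply: lt_bigmin => // i _; rewrite /r; case: (H i).
move=> i; apply: (Qle i (r i)); first exact: bigmin_le_cond.
by rewrite /r; case: (H i).
Qed.

(** The points isolated at scale [1 / (k + 1)] are separated by that distance, so
    [t |-> floor (t (k + 1))] is injective on them. *)
Lemma isolated_countable (Z : set R) :
  countable [set t | Z t /\ exists2 d, 0 < d & forall s, Z s -> `|s - t| < d -> s = t].
Proof.
pose E (k : nat) := [set t | Z t /\ forall s, Z s -> `|s - t| < k.+1%:R^-1 -> s = t].
apply: (@sub_countable _ _ _ (\bigcup_k E k)).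
  apply: subset_card_le => t [Zt [d d0 H]].
  have [k kd] : exists k : nat, k.+1%:R^-1 < d.
    exists (Num.truncn d^-1).
    rewrite invf_plt ?posrE//.
    by have /truncn_itv/andP[] : 0 <= d^-1 by rewrite invr_ge0 ltW.
  by exists k => //; split => // s Zs st; apply: H => //; exact: lt_trans kd.
apply: bigcup_countable => // k _; apply/countable_injP.
exists (fun t => pickle (Num.floor (t * k.+1%:R))).
move=> s t; rewrite !inE => -[Zs Hs] [Zt Ht] /(pcan_inj pickleK) fst.
apply: Ht => //.
have := floor_itv (s * k.+1%:R); have := floor_itv (t * k.+1%:R).
rewrite fst intrD => /andP[t1 t2] /andP[s1 s2].
rewrite -div1r ltr_pdivlMr// -[X in _ * X]ger0_norm// -normrM mulrBl ltr_norml.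
by lra.
Qed.

(** Differentiability at [t] in terms of increments over intervals around [t], the
    form in which [abs_continuous_nonincreasing] consumes it. *)
Definition straddle_deriv n (x : R -> 'cV[R]_n) (t : R) (w : 'cV[R]_n) :=
  forall e, 0 < e -> exists2 d, 0 < d & forall u v, u <= t -> t <= v -> v - u < d ->
    forall i, `|x v i 0 - x u i 0 - (v - u) * w i 0| <= e * (v - u).

Lemma derivable_straddle n (x : R -> 'cV[R]_n) (t : R) :
  derivable x t 1 -> straddle_deriv x t ('D_1 x t).
Proof.
rewrite /derivable => /cvg_ex[l xl] e e0.
have -> : 'D_1 x t = l by apply: cvg_lim.
move: xl => /cvgrPdist_lt/(_ e e0)[d /= d0 Hd].
have H (k : R) i : `|k| < d -> `|x (k + t) i 0 - x t i 0 - k * l i 0| <= e * `|k|.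
  move=> kd; have [->|k0] := eqVneq k 0.
    by rewrite add0r subrr mul0r subr0 normr0 mulr0.
  have := Hd k; rewrite /= sub0r normrN => /(_ kd k0).
  move/(le_lt_trans (ler_coord _ i))/ltW; rewrite !mxE /GRing.scale /= mulr1.
  rewrite -(@ler_pM2l _ `|k|) ?normr_gt0// -normrM mulrBr mulrA divff// mul1r.
  by rewrite distrC [leRHS]mulrC.
exists d => // u v ut tv vud i.
have := H (v - t) i; have := H (u - t) i; rewrite !subrK.
rewrite (ler0_norm (x := u - t)) ?subr_le0// (ger0_norm (x := v - t)) ?subr_ge0//.
have ud : t - u < d by lra.
have vd : v - t < d by lra.
rewrite opprB => /(_ ud) Hu /(_ vd) Hv.
have := ler_normB (x v i 0 - x t i 0 - (v - t) * l i 0)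
                  (x u i 0 - x t i 0 - (u - t) * l i 0).
rewrite (_ : _ - _ - _ - (_ - _) = x v i 0 - x u i 0 - (v - u) * l i 0); last by ring.
by lra.
Qed.

(** Absolute continuity of [g] is inherited from a curve [x]; the linear term allows
    for functions such as [b * x t i 0 - c * t]. *)
Lemma abs_continuous_dominated (V : normedModType R) (x : R -> V) (g : R -> R)
    (a b K : R) :
  0 <= K ->
  (forall u v, a <= u -> u <= v -> v <= b ->
    `|g v - g u| <= `|x v - x u| + K * (v - u)) ->
  abs_continuous_on x a b -> abs_continuous_on g a b.
Proof.
move=> K0 H ac e e0; have [|d d0 Hd] := ac (e / 2); first by rewrite divr_gt0.
have K1 : 0 < K + 1 by lra.
exists (Num.min d (e / 2 / (K + 1))); first by rewrite lt_min d0 !divr_gt0.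
move=> k u v uv tri; rewrite lt_min => /andP[s1 s2].
apply: (@le_lt_trans _ _ (\sum_i (`|x (v i) - x (u i)| + K * (v i - u i)))).
  by apply: ler_sum => i _; apply: H; have [] := uv i.
rewrite big_split /= -mulr_sumr.
have S0 : 0 <= \sum_i (v i - u i).
  by apply: sumr_ge0 => i _; rewrite subr_ge0; have [] := uv i.
have h1 := Hd k u v uv tri s1.
move: s2; rewrite ltr_pdivlMr// => s2.
rewrite [e]splitr ltr_leD//; apply: le_trans (ltW s2).
by rewrite mulrC ler_wpM2l//; lra.
Qed.

Lemma abs_continuous_subinterval (V : normedModType R) (x : R -> V) (a b c d : R) :
  a <= c -> d <= b -> abs_continuous_on x a b -> abs_continuous_on x c d.
Proof.
move=> ac db H e /H[dd dd0 Hd]; exists dd => // k u v uv; apply: Hd => i.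
by have [? ? ?] := uv i; split => //; [exact: le_trans ac _|exact: le_trans db].
Qed.

Lemma abs_continuousZ (V : normedModType R) (x : R -> V) (b s t : R) :
  abs_continuous_on x s t -> abs_continuous_on (fun r => b *: x r) s t.
Proof.
move=> ac e e0; have b1 : 0 < `|b| + 1 by rewrite ltr_wpDl.
have [|d d0 Hd] := ac (e / (`|b| + 1)); first by rewrite divr_gt0.
exists d => // k u v uv tri sd; have := Hd k u v uv tri sd.
rewrite ltr_pdivlMr// mulr_suml; apply: le_lt_trans.
apply: ler_sum => j _; rewrite -scalerBr normrZ mulrC ler_wpM2l//.
by rewrite lerDl.
Qed.

Lemma straddle_derivZ n (x : R -> 'cV[R]_n) (b t : R) w :
  straddle_deriv x t w -> straddle_deriv (fun r => b *: x r) t (b *: w).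
Proof.
move=> xw e e0; have b1 : 0 < `|b| + 1 by rewrite ltr_wpDl.
have [|d d0 Hd] := xw (e / (`|b| + 1)); first by rewrite divr_gt0.
exists d => // u v ut tv vu i; have := Hd u v ut tv vu i.
rewrite mulrAC ler_pdivlMr// => H; rewrite !mxE.
rewrite (_ : _ - _ - _ = b * (x v i 0 - x u i 0 - (v - u) * w i 0)); last by ring.
rewrite normrM mulrC; apply: le_trans H.
by rewrite ler_wpM2l// lerDl.
Qed.

(** The mean value inequality for one coordinate, from an almost-everywhere bound
    on its derivative. *)
Lemma coord_slope n (x : R -> 'cV[R]_n) i (b c s t : R) : s <= t ->
  abs_continuous_on x s t ->
  {ae lebesgue_measure, forall r, s <= r <= t -> exists2 w, straddle_deriv x r w &
    b * w i 0 <= c} ->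
  b * x t i 0 - b * x s i 0 <= c * (t - s).
Proof.
move=> st ac H; pose g r := b * x r i 0 - c * r.
suff : g t <= g s by rewrite /g mulrBr; lra.
have acg : abs_continuous_on g s t.
  apply: abs_continuous_dominated (abs_continuousZ b ac); first exact: (normr_ge0 c).
  move=> u v su uv vt; rewrite /g opprB addrACA -[X in _ + X]addrC.
  rewrite (_ : _ + _ = (b * x v i 0 - b * x u i 0) - c * (v - u)); last by ring.
  apply: (le_trans (ler_normB _ _)); rewrite normrM (ger0_norm (x := v - u)) ?subr_ge0//.
  rewrite lerD2r; have := ler_coord (b *: x v - b *: x u) i.
  by rewrite !mxE.
apply: abs_continuous_nonincreasing acg _ => //.
apply: lebesgue_aeS H => r H /H[w /(straddle_derivZ b) ww wc] e e0.
have [d d0 Hd] := ww e e0.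
exists d => // u v _ ur rv _ vu; have := Hd u v ur rv vu i.
rewrite !mxE => /(le_trans (ler_norm _)).
have vu0 : 0 <= v - u by lra.
have : (v - u) * (b * w i 0) <= (v - u) * c by rewrite ler_wpM2l.
by rewrite /g; lra.
Qed.
End Analysis.

(** * The maximal coordinate of a curve *)

Section Max.
Context {R : realType} {n : nat}.
Implicit Types (v w : 'cV[R]_n) (x : R -> 'cV[R]_n).

Definition cmax (i0 : 'I_n) v : R := \big[Num.max/v i0 0]_j v j 0.

Lemma cmax_ge i0 v j : v j 0 <= cmax i0 v.
Proof. exact: (le_bigmax _ (fun j => v j 0)). Qed.

Lemma cmax_attained i0 v : exists j, cmax i0 v = v j 0.
Proof.
rewrite /cmax; apply: (big_ind (fun c => exists j, c = v j 0)).
- by exists i0.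
- by move=> _ _ [j ->] [k ->]; rewrite maxEle; case: ifP => _; [exists k|exists j].
- by move=> j _; exists j.
Qed.

Lemma cmax_lip i0 v w (e : R) : (forall j, `|v j 0 - w j 0| <= e) ->
  `|cmax i0 v - cmax i0 w| <= e.
Proof.
move=> H; have [j vj] := cmax_attained i0 v; have [k wk] := cmax_attained i0 w.
have := cmax_ge i0 v k; have := cmax_ge i0 w j; rewrite vj wk.
have := H j; have := H k; rewrite !ler_norml => /andP[? ?] /andP[? ?] ? ?.
by apply/andP; split; lra.
Qed.

(** Only coordinates that are maximal at [t] can be maximal at a nearby time [v],
    since the others stay strictly below one of them.  If [j] is maximal at [v],
    then [cmax (x v) - cmax (x u) <= x_j v - x_j u], and this is nearly
    nonpositive because [j] is maximal at [t]. *)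
Lemma cmax_nonincreasing i0 x a b : a <= b -> abs_continuous_on x a b ->
  {ae lebesgue_measure, forall t, a <= t <= b -> exists2 w, straddle_deriv x t w &
     forall i, (forall j, x t j 0 <= x t i 0) -> w i 0 <= 0} ->
  cmax i0 (x b) <= cmax i0 (x a).
Proof.
move=> ab ac H; apply: (abs_continuous_nonincreasing (g := fun t => cmax i0 (x t)) ab).
  apply: (abs_continuous_dominated (lexx 0)) ac => u v _ _ _; rewrite mul0r addr0.
  apply: cmax_lip => j; have := ler_coord (x v - x u) j; by rewrite !mxE.
apply: lebesgue_aeS H => t H /H[w xw w0] e e0.
pose Q (i : 'I_n) (d : R) := forall u v : R, u <= t -> t <= v -> v - u < d ->
  x v i 0 = cmax i0 (x v) -> x v i 0 - x u i 0 <= e * (v - u).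
have [||d d0 Hd] := @finite_radius _ _ Q.
- by move=> i d d' dd' Qd u v ut tv vu; apply: Qd => //; exact: lt_le_trans dd'.
- move=> i; have [imax|] := pselect (forall j, x t j 0 <= x t i 0).
    have [d d0 Hd] := xw e e0; exists d => // u v ut tv vu _.
    have := Hd u v ut tv vu i; rewrite ler_norml => /andP[_].
    have : (v - u) * w i 0 <= 0 by rewrite mulr_ge0_le0 ?w0//; lra.
    by lra.
  move=> /existsNP[k /negP]; rewrite -ltNge => ik.
  have [d1 d10 Hd1] := xw 1 ltr01.
  pose W := 2 + `|w i 0| + `|w k 0|.
  have W0 : 0 < W by rewrite /W -addrA ltr_pwDl// addr_ge0.
  exists (Num.min d1 ((x t k 0 - x t i 0) / W)).
    by rewrite lt_min d10 divr_gt0// subr_gt0.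
  move=> u v ut tv; rewrite lt_min ltr_pdivlMr// => /andP[vu1 vu2] vmax; exfalso.
  have tv1 : v - t < d1 by lra.
  have := cmax_ge i0 (x v) k; rewrite -vmax.
  have := Hd1 t v (lexx t) tv tv1 k; have := Hd1 t v (lexx t) tv tv1 i.
  have vt0 : 0 <= v - t by lra.
  have hi : (v - t) * w i 0 <= (v - t) * `|w i 0| by rewrite ler_wpM2l// ler_norm.
  have hk : - ((v - t) * w k 0) <= (v - t) * `|w k 0|.
    by rewrite -mulrN ler_wpM2l// -normrN ler_norm.
  have : (v - t) * W <= (v - u) * W by rewrite ler_pM2r//; lra.
  move: vu2; rewrite /W !ler_norml => q0 q1 /andP[q2 q3] /andP[q4 q5] q6.
  clear - hi hk q0 q1 q2 q3 q4 q5 q6; lra.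
exists d => // u v _ ut tv _ vu; have [j vj] := cmax_attained i0 (x v).
have := Hd j u v ut tv vu (esym vj); rewrite vj.
by have := cmax_ge i0 (x u) j; lra.
Qed.

(** Where [x_i = x_j] but the derivatives differ, the difference [x_i - x_j] has an
    isolated zero, and isolated points are countable. *)
Lemma coincident_derivatives x : {ae lebesgue_measure, forall t, forall i j w,
  straddle_deriv x t w -> x t i 0 = x t j 0 -> w i 0 = w j 0}.
Proof.
apply: lebesgue_ae_forall => i; apply: lebesgue_ae_forall => j.
apply: lebesgue_negligibleS (countable_negligible
  (@isolated_countable R [set t | x t i 0 = x t j 0])).
move=> t /= /existsNP[w] /not_implyP[xw] /not_implyP[xij wij]; split => //.
pose D := w i 0 - w j 0.
have D0 : 0 < `|D| by rewrite normr_gt0 subr_eq0; exact/eqP.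
have e0 : 0 < `|D| / 4 by rewrite divr_gt0.
have [d d0 Hd] := xw _ e0; exists d => // s /= xs std.
apply: contrapT => st.
have st0 : 0 < `|s - t| by rewrite normr_gt0 subr_eq0; exact/eqP.
have [u [v [ut tv vu suv Z]]] : exists u v : R, [/\ u <= t, t <= v, v - u < d,
    `|s - t| = v - u & x v i 0 - x u i 0 = x v j 0 - x u j 0].
  have [lts|lst] := leP t s.
    have sE : `|s - t| = s - t by rewrite ger0_norm ?subr_ge0.
    by exists t, s; split; [|exact: lts|rewrite -sE| |rewrite xs xij].
  have sE : `|s - t| = t - s by rewrite distrC ger0_norm ?subr_ge0 ?ltW.
  by exists s, t; split; [exact: ltW| |rewrite -sE| |rewrite xs xij].
have := Hd u v ut tv vu i; have := Hd u v ut tv vu j; rewrite Z.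
move=> hj hi; have := ler_normB
  (x v j 0 - x u j 0 - (v - u) * w j 0) (x v j 0 - x u j 0 - (v - u) * w i 0).
rewrite (_ : _ - _ - _ - (_ - _) = (v - u) * D); last by rewrite /D; ring.
rewrite normrM -suv normr_id.
rewrite -suv in hi hj.
have : 0 < `|s - t| * `|D| by rewrite mulr_gt0.
by lra.
Qed.

(** Compactness of a box; the transposition only serves to use compactness of
    products, which is stated for row vectors. *)
Lemma bounded_cluster x (N : R) :
  (forall t, 0 <= t -> forall i, `|x t i 0| <= N) ->
  exists p : 'cV[R]_n, forall e T : R, 0 < e ->
    exists2 t, T <= t & forall i, `|x t i 0 - p i 0| < e.
Proof.
move=> xN; pose K := [set v : 'rV[R]_n | forall i, (`[- N, N]%classic : set R) (v ord0 i)].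
have cK : compact K.
  apply: (@rV_compact _ n (fun=> `[- N, N]%classic)) => _.
  exact: segment_compact.
pose F := (fun t => (x t)^T) @ +oo.
have FK : F K.
  exists 0; split => // t t0 i; rewrite mxE /= in_itv /= -ler_norml.
  exact/xN/ltW.
have [q [_ clq]] := cK F _ FK.
exists q^T => e T e0.
pose U := [set v : 'rV[R]_n | exists2 t, T <= t & v = (x t)^T].
have FU : F U by exists T; split; [exact: num_real|move=> t /ltW Tt; exists t].
have [v [[t Tt ->] qv]] := clq U (ball q e) FU (nbhsx_ballx q e e0).
exists t => // i; case: qv => _ /(_ ord0 i); rewrite /ball /= distrC !mxE.
by [].
Qed.
End Max.

(** * Null sets of R^n under linear forms *)

Section Null.
Context {R : realType} {n : nat}.
Implicit Types (A : set 'cV[R]_n) (v : \bar R).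

(** A witnessed upper bound on [lebesgue_outer A]: countable unions of covers then
    need no approximation of infima. *)
Definition box_covered A v := exists (D : set nat) (c : nat -> 'cV[R]_n * 'cV[R]_n),
  [/\ forall k i, (c k).1 i 0 <= (c k).2 i 0,
      A `<=` \bigcup_(k in D) box (c k) &
      (\esum_(k in D) (box_vol (c k))%:E <= v)%E].

Lemma box_vol_ge0 (c : 'cV[R]_n * 'cV[R]_n) :
  (forall i, c.1 i 0 <= c.2 i 0) -> 0 <= box_vol c.
Proof. by move=> h; apply: prodr_ge0 => i _; rewrite subr_ge0. Qed.

Lemma box_covered_null A : (forall e : R, 0 < e -> box_covered A e%:E) ->
  lebesgue_outer A = 0%E.
Proof.
move=> H; apply/eqP; rewrite eq_le; apply/andP; split.
  apply/lee_addgt0Pr => e /H[D [c [cv cA ce]]]; rewrite add0e.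
  by apply: ge_ereal_inf; eexists; [exists D, c; split; last reflexivity|].
apply/ereal_infP => _ [D [c [cv cA ->]]].
by apply: esum_ge0 => k _; rewrite lee_fin; exact: box_vol_ge0.
Qed.

Lemma box_covered_set0 v : (0 <= v)%E -> box_covered set0 v.
Proof. by move=> v0; exists set0, (fun=> (0, 0)); split => //; rewrite esum_set0. Qed.

Lemma lebesgue_outer_set0 : lebesgue_outer (set0 : set 'cV[R]_n) = 0%E.
Proof.
by apply: box_covered_null => e e0; apply: box_covered_set0; rewrite lee_fin ltW.
Qed.

Lemma box_covered_subset A B v : A `<=` B -> box_covered B v -> box_covered A v.
Proof.
by move=> AB [D [c [? cB ?]]]; exists D, c; split => //; exact: subset_trans cB.
Qed.

Lemma box_covered_le A v w : (v <= w)%E -> box_covered A v -> box_covered A w.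
Proof.
by move=> vw [D [c [? ? cv]]]; exists D, c; split => //; exact: le_trans vw.
Qed.

Lemma box_covered_countable (T : countType) (D : set T)
    (b : T -> 'cV[R]_n * 'cV[R]_n) A v :
  (forall k i, (b k).1 i 0 <= (b k).2 i 0) ->
  A `<=` \bigcup_(k in D) box (b k) ->
  (\esum_(k in D) (box_vol (b k))%:E <= v)%E -> box_covered A v.
Proof.
move=> bv Ab le_v.
exists (pickle @` D), (fun m => if unpickle m is Some t then b t else (0, 0)); split.
- by move=> k i; case: unpickle.
- by move=> z /Ab[t Dt zt]; exists (pickle t); [exists t|rewrite pickleK].
- rewrite esum_image; first by under eq_esum do rewrite pickleK.
  by move=> t u _ _; exact: (pcan_inj pickleK).
Qed.

Lemma box_covered_bigcup (A : nat -> set 'cV[R]_n) (v : nat -> \bar R) :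
  (forall k, box_covered (A k) (v k)) ->
  box_covered (\bigcup_k A k) (\esum_(k in [set: nat]) v k)%E.
Proof.
move=> /choice[D] /choice[c] H.
pose b (p : nat * nat) := c p.1 p.2.
apply: (@box_covered_countable (nat * nat)%type ([set: nat] `*`` D) b).
- by move=> p i; have [+ _ _] := H p.1; exact.
- move=> z [k _ Az]; have [_ /(_ z Az)[m Dm zm] _] := H k.
  by exists (k, m).
- rewrite -(esum_esum (a := fun i j => (box_vol (c i j))%:E)); last first.
    by move=> i j _ _; rewrite lee_fin; apply: box_vol_ge0; have [] := H i.
  by apply: le_esum => k _; have [] := H k.
Qed.

Lemma box_covered_finite (T : finType) (b : T -> 'cV[R]_n * 'cV[R]_n) A :
  (forall k i, (b k).1 i 0 <= (b k).2 i 0) ->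
  (forall z, A z -> exists k, box (b k) z) ->
  box_covered A (\sum_k box_vol (b k))%:E.
Proof.
move=> bv Ab; apply: (@box_covered_countable T [set: T] b) => //.
  by move=> z /Ab[k zk]; exists k.
rewrite esum_fset; [|exact: finite_finset|]; last first.
  by move=> t _; rewrite lee_fin; exact: box_vol_ge0.
rewrite -sumEFin le_eqVlt; apply/orP; left; apply/eqP/esym.
rewrite -[in RHS]set_true; apply: bigfs; first exact: index_enum_uniq.
by move=> i _; rewrite mem_index_enum.
Qed.

(** Inside a cube, the slab [al <= c . x <= al + lam] is cut by a grid of step
    [s <= lam] in the coordinates other than [k].  Over each cell the form varies by
    at most [C * s] apart from [c_k x_k], so [x_k] is confined to an interval of
    half-width [h], proportional to [lam].  The number of cells times the volume of
    one box is at most [K * lam], where [K] does not depend on [lam]. *)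
Lemma slab_covered (c : 'I_n -> R) (k : 'I_n) (N : R) : c k != 0 -> 0 < N ->
  exists2 K : R, 0 < K & forall al lam : R, 0 < lam ->
    box_covered [set x : 'cV[R]_n | (forall j, `|x j 0| < N) /\
                    al <= \sum_j c j * x j 0 <= al + lam] (K * lam)%:E.
Proof.
move=> ck N0.
pose C := \sum_j `|c j|.
have C0 : 0 <= C by apply: sumr_ge0.
pose K := (1 + 2 * C) / `|c k| * \prod_(j < n | j != k) (2 * N).
have ack : 0 < `|c k| by rewrite normr_gt0.
have P0 : 0 < \prod_(j < n | j != k) (2 * N) by apply: prodr_gt0 => j _; lra.
exists K; first by rewrite mulr_gt0// divr_gt0//; lra.
move=> al lam lam0.
pose M := Num.truncn (2 * N / lam).
pose s := 2 * N / M.+1%:R.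
have M0 : 0 < M.+1%:R :> R by [].
have s0 : 0 < s by rewrite divr_gt0//; lra.
have sM : M.+1%:R * s = 2 * N by rewrite /s mulrCA mulfV ?mulr1// gt_eqF.
have slam : s <= lam.
  have /truncn_itv/andP[_] : 0 <= 2 * N / lam by rewrite divr_ge0 ?mulr_ge0// ltW.
  rewrite -/M ltr_pdivrMr// /s ler_pdivrMr// => /ltW.
  by rewrite (mulrC lam).
pose p (g : {ffun 'I_n -> 'I_M.+1}) j := - N + (g j)%:R * s.
pose q g := \sum_(j < n | j != k) c j * p g j.
pose z g := (al + lam / 2 - q g) / c k.
pose h := (lam / 2 + C * s) / `|c k|.
have h0 : 0 <= h.
  rewrite divr_ge0//; have : 0 <= C * s by rewrite mulr_ge0// ltW.
  by lra.
(* The cells are indexed by all [g : 'I_n -> 'I_M.+1], so that the total volume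
   factors by [bigA_distr_bigA]; to count no cell twice, the boxes with
   [g k <> 0] are degenerate. *)
pose wid (j : 'I_n) (i : 'I_M.+1) : R :=
  if j == k then (if i == ord0 then 2 * h else 0) else s.
pose lo g j := if j == k then z g - wid j (g j) / 2 else p g j.
pose b g : 'cV[R]_n * 'cV[R]_n :=
  (\col_j lo g j, \col_j (lo g j + wid j (g j))).
have wid0 j i : 0 <= wid j i by rewrite /wid; do 2?case: ifP => _ //; lra.
apply: (@box_covered_le _ (\sum_g box_vol (b g))%:E).
  rewrite lee_fin /box_vol.
  under eq_bigr do under eq_bigr do rewrite /b !mxE addrC addKr.
  rewrite -bigA_distr_bigA (bigD1 k)//= (bigD1 ord0)//= [X in _ + X]big1 ?addr0; last first.
    by move=> i /negbTE i0; rewrite /wid eqxx i0.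
  have -> : \prod_(i < n | i != k) \sum_(j < M.+1) wid i j =
            \prod_(j < n | j != k) (2 * N).
    apply: eq_bigr => j jk; rewrite -sM mulr_natl /wid (negbTE jk).
    by rewrite sumr_const card_ord.
  rewrite {1}/wid !eqxx /K [leRHS]mulrAC ler_pM2r// mulrAC.
  rewrite /h mulrA ler_pM2r ?invr_gt0// mulrDr.
  have : C * s <= C * lam by rewrite ler_wpM2l.
  by lra.
apply: box_covered_finite; first by move=> g i; rewrite !mxE lerDl.
move=> x [xN xal].
have gP j : (Num.truncn ((x j 0 + N) / s)%R < M.+1)%N.
  have := xN j; rewrite ltr_norml => /andP[? ?].
  rewrite truncn_lt_nat; last by rewrite divr_ge0//; lra.
  by rewrite ltr_pdivrMr// sM; lra.
pose g := [ffun j => if j == k then ord0 else Ordinal (gP j)].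
have gk : g k = ord0 by rewrite ffunE eqxx.
have gE j : j != k -> p g j <= x j 0 <= p g j + s.
  move=> jk; rewrite /p ffunE (negbTE jk) /=.
  have xj : 0 <= x j 0 + N.
    by have := xN j; rewrite ltr_norml => /andP[? ?]; lra.
  have /truncn_itv : 0 <= (x j 0 + N) / s by rewrite divr_ge0// ltW.
  set t := Num.truncn _.
  rewrite ler_pdivlMr// ltr_pdivrMr// -natr1 mulrDl mul1r => /andP[? ?].
  by lra.
exists g => i; rewrite !mxE /lo /wid; case: eqVneq => [->|ik]; last exact: gE.
rewrite gk eqxx.
suff : `|x k 0 - z g| <= h by rewrite ler_norml => /andP[? ?]; lra.
rewrite -(ler_pM2l ack) -normrM mulrBr /z /h [leRHS]mulrC divfK ?gt_eqF//.
rewrite (mulrC (c k) (_ / _)) divfK//.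
move: xal; rewrite (bigD1 k)//=; set S := \sum_(j < n | _) _ => Sal.
have : `|S - q g| <= C * s.
  rewrite /S /q -sumrB (le_trans (ler_norm_sum _ _ _))//.
  rewrite /C [in leRHS](bigD1 k)//= mulrDl mulr_suml -[leLHS]add0r lerD//.
    by rewrite mulr_ge0// ltW.
  apply: ler_sum => j jk; rewrite -mulrBr normrM ler_wpM2l// ler_norml.
  by have /andP[? ?] := gE j jk; lra.
rewrite !ler_norml => /andP[? ?]; lra.
Qed.

(** A cover of [S] by short intervals pulls back, within each cube, to a cover by
    thin slabs of proportional total volume; the cubes of half-side [N + 1] then
    exhaust the space, and the budget [e / 2 ^ (N + 1)] is summable. *)
Lemma lebesgue_outer_preimage (c : 'I_n -> R) (k : 'I_n) (S : set R) :
  c k != 0 -> (@lebesgue_measure R).-negligible S ->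
  lebesgue_outer [set x : 'cV[R]_n | S (\sum_j c j * x j 0)] = 0%E.
Proof.
move=> ck /negligible_outer_measure S0; apply: box_covered_null => e e0.
pose A N := [set x : 'cV[R]_n | (forall j, `|x j 0| < N.+1%:R) /\
                                S (\sum_j c j * x j 0)].
have cover N : box_covered (A N) (e / (2 ^ N.+1)%:R)%:E.
  have N0 : 0 < N.+1%:R :> R by [].
  have [K K0 HK] := slab_covered ck N0.
  pose d := e / (2 ^ N.+1)%:R / K.
  have d0 : 0 < d by rewrite !divr_gt0// ltr0n expn_gt0.
  have : ((wlength idfun)^*%mu S : \bar R) \is a fin_num by rewrite S0.
  rewrite outer_measure_open_itv_cover => /(lb_ereal_inf_adherent d0).
  rewrite -outer_measure_open_itv_cover S0 add0e => -[_ /= [F [Fitv SF] <-] Fd].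
  have {}Fitv := choice Fitv.
  case: Fitv => ab Fab.
  pose B m := [set x : 'cV[R]_n | (forall j, `|x j 0| < N.+1%:R) /\
                                F m (\sum_j c j * x j 0)].
  have cB m : box_covered (B m) (K%:E * wlength idfun (F m))%E.
    rewrite Fab wlength_itv /= lte_fin; case: ltP => abm.
      rewrite -EFinD -EFinM.
      apply: box_covered_subset (HK (ab m).1 _ _); last by rewrite subr_gt0.
      move=> x [xN]; rewrite Fab /= in_itv /= => /andP[? ?]; split => //.
      by rewrite subrKC !ltW.
    rewrite mule0; apply: (@box_covered_subset _ set0).
      move=> x [_]; rewrite Fab /= in_itv /= => /andP[xa xb].
      by have := lt_trans xa xb; rewrite ltNge abm.
    exact: box_covered_set0.
  apply: (@box_covered_subset _ (\bigcup_m B m)).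
    by move=> x [xN /SF[m _ Fm]]; exists m.
  apply: box_covered_le (box_covered_bigcup cB).
  rewrite -nneseries_esumT; last first.
    by move=> m; rewrite mule_ge0// lee_fin ltW.
  rewrite nneseriesZl; last by move=> m _; exact: wlength_ge0.
  rewrite -[e / _](@divfK _ K) ?gt_eqF// -/d mulrC EFinM lee_pmul2l// ?lte_fin//.
  exact: ltW.
apply: (@box_covered_subset _ (\bigcup_N A N)).
  move=> x Sx; pose m := \big[Num.max/0]_j `|x j 0|.
  have m0 : 0 <= m by apply: bigmax_ge_id.
  have /truncn_itv/andP[_ mt] := m0.
  exists (Num.truncn m) => //; split => // j; apply: le_lt_trans mt.
  exact: le_bigmax.
apply: box_covered_le (box_covered_bigcup cover).
rewrite -nneseries_esumT; first exact/epsilon_trick0/ltW.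
by move=> N; rewrite lee_fin divr_ge0// ltW.
Qed.
End Null.

(** * Half-spaces and the Filippov map *)

Section Filippov.
Context {R : realType}.

(** Otherwise [phi] would take arbitrarily small values, of the sign of [y], on
    non-null sets arbitrarily near [y].  Then [0] would be in every closed set
    that occurs in the definition of [filippov1 phi y], contradicting that
    [y * filippov1 phi y] has a positive minimum. *)
Lemma sign_preserving_ess (phi : R -> R) (y : R) : sign_preserving phi -> y != 0 ->
  exists kappa d : R, [/\ 0 < kappa, 0 < d &
    (@lebesgue_measure R).-negligible
      [set z | ball y d z /\ Num.sg y * phi z < kappa]].
Proof.
move=> [_ sp] y0; apply: contrapT => H.
have [_ [m [_ lbm m0]]] := sp y y0.
have : m <= y * 0.
  apply: lbm; exists 0 => // d /= d0 S /= Snegl C [Ccl _ CS].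
  apply: Ccl => B /nbhs_ballP[k /= k0 kB].
  pose d' := Num.min d `|y|.
  have d'0 : 0 < d' by rewrite lt_min d0 normr_gt0.
  have : ~ ([set z | ball y d' z /\ Num.sg y * phi z < k] `<=` S).
    by move=> /lebesgue_negligibleS/(_ Snegl) N; apply: H; exists k, d'.
  move=> /existsNP[z /not_implyP[[yz zk] nSz]].
  move: yz; rewrite /ball /= lt_min => /andP[yzd yzy].
  exists (phi z); split; first by apply: CS; exists z.
  apply: kB; rewrite /ball /= sub0r normrN.
  have syz : Num.sg z = Num.sg y.
    have [yn|yp|] := ltgtP y 0; last by move/eqP: y0.
    - rewrite [RHS]ltr0_sg// ltr0_sg//; move: yzy.
      by rewrite (ltr0_norm yn) ltr_norml => /andP[? ?]; lra.
    - rewrite [RHS]gtr0_sg// gtr0_sg//; move: yzy.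
      by rewrite (gtr0_norm yp) ltr_norml => /andP[? ?]; lra.
  have z0 : z != 0 by rewrite -sgr_eq0 syz sgr_eq0.
  have [zz _] := sp z z0.
  suff -> : `|phi z| = Num.sg y * phi z by [].
  rewrite -syz; have [zn|zp|z00] := ltgtP z 0; last by rewrite z00 eqxx in z0.
  - by move: zz; rewrite nmulr_rgt0// => p0; rewrite ltr0_sg// ltr0_norm// mulN1r.
  - by move: zz; rewrite pmulr_rgt0// => p0; rewrite gtr0_sg// gtr0_norm// mul1r.
by rewrite mulr0 leNgt m0.
Qed.

Lemma linform_lipschitz n (a : 'I_n -> R) (u v : 'cV[R]_n) (e : R) :
  (forall i, `|u i 0 - v i 0| <= e) ->
  `|\sum_i a i * u i 0 - \sum_i a i * v i 0| <= (\sum_i `|a i|) * e.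
Proof.
move=> uv; rewrite -sumrB (le_trans (ler_norm_sum _ _ _))// mulr_suml.
by apply: ler_sum => i _; rewrite -mulrBr normrM ler_wpM2l.
Qed.

Lemma closed_halfspace n (a : 'I_n -> R) (c : R) :
  closed [set w : 'cV[R]_n | \sum_i a i * w i 0 <= c].
Proof.
move=> w cw /=; rewrite leNgt; apply/negP => cs.
pose C := 1 + \sum_i `|a i|.
have C0 : 0 < C by rewrite ltr_pwDl// sumr_ge0.
pose e := (\sum_i a i * w i 0 - c) / C.
have e0 : 0 < e by rewrite divr_gt0// subr_gt0.
have [|v [/= vc]] := cw (ball w e); first exact: nbhsx_ballx.
rewrite -ball_normE /= => wv.
have := @linform_lipschitz n a w v `|w - v|.
have H i : `|w i 0 - v i 0| <= `|w - v|.
  by have := ler_coord (w - v) i; rewrite !mxE.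
move=> /(_ H); rewrite ler_norml => /andP[_ H1].
have H2 : C * `|w - v| < C * e by rewrite ltr_pM2l.
move: H2; rewrite /e mulrCA mulfV ?gt_eqF// mulr1 /C mulrDl mul1r.
by have := normr_ge0 (w - v); lra.
Qed.

Lemma convex_halfspace n (a : 'I_n -> R) (c : R) :
  convex_set [set w : 'cV[R]_n | \sum_i a i * w i 0 <= c].
Proof.
move=> u v l; rewrite !inE /= => hu hv.
rewrite (_ : \sum_i _ = l%:num * (\sum_i a i * u i 0) +
                        (1 - l%:num) * (\sum_i a i * v i 0)); last first.
  rewrite !mulr_sumr -big_split /=; apply: eq_bigr => i _.
  by rewrite !mxE mulrDr; congr (_ + _); rewrite mulrCA.
have : l%:num * (\sum_i a i * u i 0) <= l%:num * c by rewrite ler_wpM2l.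
have : (1 - l%:num) * (\sum_i a i * v i 0) <= (1 - l%:num) * c.
  by rewrite ler_wpM2l// subr_ge0.
by rewrite mulrBl mul1r; lra.
Qed.

(** The half-space is one of the closed convex sets intersected by
    [closed_convex_hull]. *)
Lemma filippov_halfspace n (F : 'cV[R]_n -> 'cV[R]_n) (x w : 'cV[R]_n)
    (a : 'I_n -> R) (c d : R) (S : set 'cV[R]_n) :
  0 < d -> lebesgue_outer S = 0%E ->
  (forall z, eball x d z -> ~ S z -> \sum_i a i * F z i 0 <= c) ->
  filippov F x w -> \sum_i a i * w i 0 <= c.
Proof.
move=> d0 S0 H /(_ d d0 S S0) /(_ [set w | \sum_i a i * w i 0 <= c]); apply; split.
- exact: closed_halfspace.
- exact: convex_halfspace.
- by move=> _ [z [xz Sz] <-]; exact: H.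
Qed.

Lemma filippov_coord_ge n (F : 'cV[R]_n -> 'cV[R]_n) (x w : 'cV[R]_n)
    (i : 'I_n) (b c d : R) (S : set 'cV[R]_n) :
  0 < d -> lebesgue_outer S = 0%E ->
  (forall z, eball x d z -> ~ S z -> c <= b * F z i 0) ->
  filippov F x w -> c <= b * w i 0.
Proof.
move=> d0 S0 H Fw; rewrite -lerN2.
have sumE (u : 'cV[R]_n) : \sum_j (if j == i then - b else 0) * u j 0 = - (b * u i 0).
  rewrite (bigD1 i)//= eqxx big1 ?addr0 ?mulNr// => j /negbTE ->.
  by rewrite mul0r.
rewrite -sumE; apply: (filippov_halfspace d0 S0 _ Fw) => z xz Sz.
by rewrite sumE lerN2; exact: H.
Qed.

Lemma eball_coord n (x z : 'cV[R]_n) d i : eball x d z -> `|z i 0 - x i 0| < d.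
Proof.
move=> /=; apply: le_lt_trans; rewrite distrC -sqrtr_sqr ler_wsqrtr//.
by rewrite (bigD1 i)//= lerDl; apply: sumr_ge0 => j _; exact: sqr_ge0.
Qed.
Lemma filippov_linform_abs n (F : 'cV[R]_n -> 'cV[R]_n) (x w : 'cV[R]_n)
    (a : 'I_n -> R) (c d : R) (S : set 'cV[R]_n) :
  0 < d -> lebesgue_outer S = 0%E ->
  (forall z, eball x d z -> ~ S z -> `|\sum_i a i * F z i 0| <= c) ->
  filippov F x w -> `|\sum_i a i * w i 0| <= c.
Proof.
move=> d0 S0 H Fw; rewrite ler_norml lerNl -sumrN.
under eq_bigr do rewrite -mulNr.
apply/andP; split; apply: (filippov_halfspace d0 S0 _ Fw) => z xz Sz.
  under eq_bigr do rewrite mulNr.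
  by rewrite sumrN lerNl; have := H z xz Sz; rewrite ler_norml => /andP[].
by have := H z xz Sz; rewrite ler_norml => /andP[].
Qed.

Lemma filippov_coord_abs n (F : 'cV[R]_n -> 'cV[R]_n) (x w : 'cV[R]_n)
    (i : 'I_n) (c d : R) (S : set 'cV[R]_n) :
  0 < d -> lebesgue_outer S = 0%E ->
  (forall z, eball x d z -> ~ S z -> `|F z i 0| <= c) ->
  filippov F x w -> `|w i 0| <= c.
Proof.
move=> d0 S0 H Fw.
have sumE (u : 'cV[R]_n) : \sum_j (j == i)%:R * u j 0 = u i 0.
  rewrite (bigD1 i)//= eqxx mul1r big1 ?addr0// => j /negbTE ->.
  by rewrite mul0r.
rewrite -sumE; apply: (filippov_linform_abs d0 S0 _ Fw) => z xz Sz.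
by rewrite sumE; exact: H.
Qed.

End Filippov.

(** * Disagreement and roots of a weighted digraph *)

Section Field.
Context {R : realType} {n : nat}.
Variables (G : wdigraph R n).
Implicit Types (x z w : 'cV[R]_n) (i j : 'I_n).

Lemma laplacianE i j :
  laplacian G i j = (\sum_k wd_adj G i k) *+ (i == j) - wd_adj G i j.
Proof. by rewrite /laplacian !mxE. Qed.

(** The [i]-th entry of [- L x]. *)
Definition disagreement x i : R := \sum_j wd_adj G i j * (x j 0 - x i 0).

Lemma disagreementE x i :
  disagreement x i = \sum_j (- laplacian G i j) * x j 0.
Proof.
rewrite /disagreement (eq_bigr _ (fun j _ => mulrBr _ _ _)) sumrB -mulr_suml.
rewrite [RHS](eq_bigr (fun j => wd_adj G i j * x j 0 -
   ((\sum_k wd_adj G i k) *+ (i == j)) * x j 0)); last first.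
  by move=> j _; rewrite laplacianE mulNr mulrBl opprB.
rewrite sumrB; congr (_ - _).
rewrite [RHS](bigD1 i)//= eqxx mulr1n [X in _ + X]big1 ?addr0// => j ji.
by rewrite eq_sym (negbTE ji) mulr0n mul0r.
Qed.

Lemma consensus_fieldE f x i : consensus_field G f x i 0 = f i (disagreement x i).
Proof.
rewrite /consensus_field !mxE disagreementE; congr (f i _).
by rewrite -sumrN; apply: eq_bigr => j _; rewrite !mxE mulNr.
Qed.

Lemma disagreement_const x i :
  (forall j, wd_edge G j i -> x j 0 = x i 0) -> disagreement x i = 0.
Proof.
move=> H; apply: big1 => j _; have := wd_adj_ge0 G i j.
rewrite le0r => /orP[/eqP ->|]; first by rewrite mul0r.
by rewrite wd_adj_gt0 => /H ->; rewrite subrr mulr0.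
Qed.

Lemma disagreement_max_le0 x i : (forall j, x j 0 <= x i 0) -> disagreement x i <= 0.
Proof.
move=> H; apply: sumr_le0 => j _.
by rewrite mulr_ge0_le0 ?wd_adj_ge0// subr_le0.
Qed.

(** At a maximal coordinate, the disagreement is a sum of nonpositive terms. *)
Lemma disagreement_max_eq0 x i : (forall j, x j 0 <= x i 0) ->
  disagreement x i = 0 -> forall j, wd_edge G j i -> x j 0 = x i 0.
Proof.
move=> H D0 j; rewrite -wd_adj_gt0 => Aij.
have : \sum_k wd_adj G i k * (x i 0 - x k 0) = 0.
  transitivity (- disagreement x i); last by rewrite D0 oppr0.
  rewrite /disagreement -sumrN; apply: eq_bigr => k _.
  by rewrite -mulrN opprB.
move/psumr_eq0P => /(_ _ j isT).
rewrite -{2}[0](mulr0 (wd_adj G i j)) => /(_ _)/(mulfI (lt0r_neq0 Aij)) HH.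
apply/esym/eqP; rewrite -subr_eq0 HH// => k _.
by rewrite mulr_ge0 ?wd_adj_ge0// subr_ge0.
Qed.

Lemma disagreementZ b x i : disagreement (b *: x) i = b * disagreement x i.
Proof.
rewrite /disagreement mulr_sumr; apply: eq_bigr => j _.
by rewrite !mxE -mulrBr mulrCA.
Qed.

Lemma disagreement_lip : exists2 C : R, 0 < C & forall x z i e,
  (forall j, `|x j 0 - z j 0| <= e) ->
  `|disagreement x i - disagreement z i| <= C * e.
Proof.
exists (1 + \sum_i \sum_j `|laplacian G i j|).
  by rewrite ltr_pwDl// sumr_ge0// => i _; rewrite sumr_ge0.
move=> x z i e H; rewrite !disagreementE.
apply: (le_trans (linform_lipschitz _ H)); apply: ler_wpM2r.
  exact: le_trans (H i).
under eq_bigr do rewrite normrN.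
rewrite [in leRHS](bigD1 i)//= addrCA -[leLHS]addr0 lerD2l addr_ge0//.
by apply: sumr_ge0 => k _; rewrite sumr_ge0.
Qed.

(** An edge into [i] ensures that the linear form is not zero. *)
Lemma disagreement_null i j (S : set R) : wd_edge G j i ->
  (@lebesgue_measure R).-negligible S ->
  lebesgue_outer [set x | S (disagreement x i)] = 0%E.
Proof.
move=> eji Sn.
have -> : [set x | S (disagreement x i)] =
          [set x | S (\sum_j (- laplacian G i j) * x j 0)].
  by apply/seteqP; split=> x /=; rewrite disagreementE.
apply: (@lebesgue_outer_preimage _ _ _ j) Sn; apply: lt0r_neq0.
have ij : i != j.
  by apply/eqP => ij; move: eji; rewrite -wd_adj_gt0 ij wd_adj_diag ltxx.
by rewrite laplacianE (negbTE ij) mulr0n sub0r opprK wd_adj_gt0.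
Qed.

Section Graph.
Local Notation e := (wd_edge G).

Lemma is_root_edge i j : is_root G i -> e j i -> is_root G j.
Proof.
move=> /forallP Hi ji; apply/forallP => k.
exact: connect_trans (connect1 ji) (Hi k).
Qed.

(** A set closed under in-neighbours contains every node from which one of its
    nodes can be reached. *)
Lemma root_sub_closed (A : pred 'I_n) i r : (forall i j, A i -> e j i -> A j) ->
  A i -> is_root G r -> A r.
Proof.
move=> Acl Ai /forallP/(_ i)/connectP[p].
elim: p r => [|k p IH] r /= ; first by move=> _ <-.
by case/andP=> rk kp ip; apply: Acl rk; exact: IH kp ip.
Qed.

(** In-neighbours of roots are roots, so the last edge of a path from [s] to [r]
    starts at a root. *)
Lemma root_in_edge r s : is_root G r -> is_root G s -> s != r ->
  exists2 j, e j r & is_root G j.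
Proof.
move=> Hr Hs sr; have /forallP/(_ r)/connectP[p] := Hs.
case/lastP: p => [|p j]; first by move=> _ rs; rewrite rs eqxx in sr.
rewrite last_rcons rcons_path => /andP[_ lj] rj; rewrite -rj in lj.
by exists (last s p) => //; exact: is_root_edge Hr lj.
Qed.

Lemma wd_edge_irrefl i : e i i = false.
Proof. by rewrite -wd_adj_gt0 wd_adj_diag ltxx. Qed.
End Graph.
End Field.

(** * Filippov velocities of the consensus field *)

Section FieldFacts.
Context {R : realType} {n : nat}.
Variables (G : wdigraph R n) (f : 'I_n -> R -> R).
Hypothesis f_sign : forall i, sign_preserving (f i).
Hypothesis f_bnd : forall i, locally_ess_bounded (f i).
Local Notation h := (consensus_field G f).
Implicit Types (x z w : 'cV[R]_n) (i j : 'I_n).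

Let f0 i : f i 0 = 0. Proof. by have [] := f_sign i. Qed.

Lemma disagreement_eball : exists2 C : R, 0 < C & forall x z i d,
  eball x d z -> `|disagreement G z i - disagreement G x i| <= C * d.
Proof.
have [C C0 HC] := disagreement_lip G; exists C => // x z i d xz.
by apply: HC => j; exact/ltW/eball_coord.
Qed.

(** The essential form of sign preservation, transferred to the state space: a
    lower bound on the speed that is uniform near any state with disagreement
    [y <> 0]. *)
Lemma velocity_push i (y : R) : y != 0 -> exists kappa rho : R,
  [/\ 0 < kappa, 0 < rho & forall x w, `|disagreement G x i - y| < rho ->
    filippov h x w -> kappa <= Num.sg y * w i 0].
Proof.
move=> y0; have [kappa [d [k0 d0 Sn]]] := sign_preserving_ess (f_sign i) y0.
have [C C0 HC] := disagreement_eball.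
exists kappa, (Num.min (d / 2) `|y|); split => //.
  by rewrite lt_min divr_gt0//= normr_gt0.
move=> x w; rewrite lt_min => /andP[xd xy] Fw.
have [j ji] : exists j, wd_edge G j i.
  apply: contrapT => nj; move: xy; rewrite disagreement_const.
    by rewrite sub0r normrN ltxx.
  by move=> j ji; exfalso; apply: nj; exists j.
have r0 : 0 < d / 2 / C by rewrite !divr_gt0.
apply: (filippov_coord_ge r0 (disagreement_null ji Sn) _ Fw) => z xz nS.
rewrite consensus_fieldE leNgt; apply/negP => zk; apply: nS; split => //.
have := HC x z i _ xz; rewrite mulrCA mulfV ?gt_eqF// mulr1 => zx.
rewrite /ball /= distrC.
have := ler_distD (disagreement G x i) (disagreement G z i) y; lra.
Qed.

Lemma velocity_no_in_edge i x w : (forall j, ~~ wd_edge G j i) ->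
  filippov h x w -> w i 0 = 0.
Proof.
move=> ne Fw; apply/normr0_eq0/eqP; rewrite eq_le normr_ge0 andbT.
apply: (filippov_coord_abs ltr01 lebesgue_outer_set0 _ Fw) => z _ _.
rewrite consensus_fieldE disagreement_const ?f0 ?normr0// => j.
by rewrite (negbTE (ne j)).
Qed.

Lemma velocity_bounded (N : R) : exists2 B : R, 0 < B & forall x w,
  (forall j, `|x j 0| <= N) -> filippov h x w -> forall i, `|w i 0| <= B.
Proof.
have [C C0 HC] := disagreement_lip G.
pose D := C * (N + 1).
have /choice[M HM] : forall i, exists M, {ae lebesgue_measure,
    forall y, (`[- D, D]%classic : set R) y -> `|f i y| <= M}.
  by move=> i; apply: f_bnd; exact: segment_compact.
exists (1 + \sum_i `|M i|); first by rewrite ltr_pwDl// sumr_ge0.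
move=> x w xN Fw i.
apply: (@le_trans _ _ `|M i|); last first.
  by rewrite (bigD1 i)//= addrCA lerDl addr_ge0// sumr_ge0.
have [/existsP[j ji]|] := boolP [exists j, wd_edge G j i]; last first.
  by rewrite negb_exists => /forallP ne; rewrite (velocity_no_in_edge ne Fw) normr0.
apply: (filippov_coord_abs ltr01 (disagreement_null ji (HM i)) _ Fw) => z xz nS.
rewrite consensus_fieldE leNgt; apply/negP => Mf; apply: nS => /= H.
suff /H fM : (`[- D, D]%classic : set R) (disagreement G z i).
  by have := lt_le_trans Mf (le_trans fM (ler_norm _)); rewrite ltxx.
rewrite /= in_itv /= -ler_norml.
have -> : disagreement G z i = disagreement G z i - disagreement G 0 i.
  by rewrite (disagreement_const (x := 0)) ?subr0// => k _; rewrite !mxE.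
apply: HC => k; rewrite mxE subr0.
have := eball_coord k xz; have := xN k.
by have := ler_normD (z k 0 - x k 0) (x k 0); rewrite subrK; lra.
Qed.

(** Continuity bounds [f i] at every point near [0], so the inequality for the field
    holds on a whole ball, without pulling back a null set. *)
Lemma velocity_cont0 i x w : {for 0, continuous (f i)} -> disagreement G x i = 0 ->
  filippov h x w -> w i 0 = 0.
Proof.
move=> /cvgrPdist_lt fc x0 Fw; apply/normr0_eq0/eqP; rewrite eq_le normr_ge0 andbT.
apply/ler_addgt0Pr => e e0; rewrite add0r.
have /nbhs_ballP[d /= d0 Hd] := fc e e0.
have [C C0 HC] := disagreement_eball.
have r0 : 0 < d / 2 / C by rewrite !divr_gt0.
apply: (filippov_coord_abs r0 lebesgue_outer_set0 _ Fw) => z xz _.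
rewrite consensus_fieldE.
have := HC x z i _ xz; rewrite mulrCA mulfV ?gt_eqF// mulr1 x0 subr0 => zx.
have /Hd : ball 0 d (disagreement G z i).
  by rewrite /ball /= sub0r normrN; lra.
by rewrite f0 sub0r normrN => /ltW.
Qed.

Lemma right_limit_ge0 i (lp : R) : f i y @[y --> 0^'+] --> lp -> 0 <= lp.
Proof.
move=> fp; apply: (@cvgr_to_ge _ _ _ _ _ _ _ fp).
near=> y.
have y0 : 0 < y by near: y; exact: nbhs_right_gt.
have [_ /(_ y (lt0r_neq0 y0))[+ _]] := f_sign i.
by rewrite pmulr_rgt0// => /ltW.
Unshelve. all: by end_near. Qed.

Lemma one_sided_limits i (lm lp e : R) : 0 < e ->
  f i y @[y --> 0^'-] --> lm -> f i y @[y --> 0^'+] --> lp ->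
  exists2 d : R, 0 < d & forall y, `|y| < d ->
    (0 < y -> `|f i y - lp| <= e) /\ (y < 0 -> `|f i y - lm| <= e).
Proof.
move=> e0 /cvgrPdist_lt/(_ e e0) [d1 /= d10 H1] /cvgrPdist_lt/(_ e e0) [d2 /= d20 H2].
exists (Num.min d1 d2); first by rewrite lt_min d10.
move=> y; rewrite lt_min => /andP[y1 y2]; split => y0; rewrite distrC ltW//.
  by apply: H2 => //; rewrite /= sub0r normrN.
by apply: H1 => //; rewrite /= sub0r normrN.
Qed.

(** Off the hyperplane [z_r = z_s], the two disagreements have opposite nonzero
    signs, so [(h_r, h_s)] is close to [(p, - q)] or to [(- p, q)]; both are
    annihilated by the form [q * w_r + p * w_s], hence so is the limiting velocity.
    With [w_r = w_s] this leaves [(p + q) * w_r = 0]; if [p + q = 0] then [p = 0],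
    and [`|w_r| <= p]. *)
Lemma velocity_two_roots r s x w (p q : R) : r != s ->
  (forall j, wd_edge G j r = (j == s)) -> (forall j, wd_edge G j s = (j == r)) ->
  f r y @[y --> 0^'-] --> - p -> f r y @[y --> 0^'+] --> p ->
  f s y @[y --> 0^'-] --> - q -> f s y @[y --> 0^'+] --> q ->
  x r 0 = x s 0 -> filippov h x w -> w r 0 = w s 0 -> w r 0 = 0.
Proof.
move=> rs Er Es rm rp sm sp xrs Fw wrs.
have p0 := right_limit_ge0 rp; have q0 := right_limit_ge0 sp.
have disr z : disagreement G z r = wd_adj G r s * (z s 0 - z r 0).
  rewrite /disagreement (bigD1 s)//= big1 ?addr0// => j js.
  have : ~~ (0 < wd_adj G r j) by rewrite wd_adj_gt0 Er.
  by rewrite lt0r wd_adj_ge0 andbT negbK => /eqP ->; rewrite mul0r.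
have diss z : disagreement G z s = wd_adj G s r * (z r 0 - z s 0).
  rewrite /disagreement (bigD1 r)//= big1 ?addr0// => j js.
  have : ~~ (0 < wd_adj G s j) by rewrite wd_adj_gt0 Es.
  by rewrite lt0r wd_adj_ge0 andbT negbK => /eqP ->; rewrite mul0r.
have Ar : 0 < wd_adj G r s by rewrite wd_adj_gt0 Er.
have As : 0 < wd_adj G s r by rewrite wd_adj_gt0 Es.
have [C C0 HC] := disagreement_eball.
have sr : s != r by rewrite eq_sym.
have est e : 0 < e -> exists d S, [/\ 0 < d, lebesgue_outer S = 0%E &
    forall z, eball x d z -> ~ S z ->
      (`|h z r 0 - p| <= e /\ `|h z s 0 + q| <= e) \/
      (`|h z r 0 + p| <= e /\ `|h z s 0 - q| <= e)].
  move=> e0.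
  have [dr dr0 Hr] := one_sided_limits e0 rm rp.
  have [ds ds0 Hs] := one_sided_limits e0 sm sp.
  have null0 : (@lebesgue_measure R).-negligible [set 0 : R].
    by exists [set 0]; split => //; exact: lebesgue_measure_set1.
  have srE : wd_edge G s r by rewrite Er.
  exists (Num.min dr ds / 2 / C), [set z | [set 0] (disagreement G z r)]; split.
  - by rewrite !divr_gt0// lt_min dr0.
  - exact: disagreement_null srE null0.
  move=> z xz /= nz.
  have := HC x z r _ xz; have := HC x z s _ xz.
  rewrite mulrCA mulfV ?gt_eqF// mulr1.
  rewrite [disagreement G x s]diss [disagreement G x r]disr xrs subrr !mulr0 !subr0.
  move=> zs zr.
  have m0 : 0 < Num.min dr ds by rewrite lt_min dr0.
  have : Num.min dr ds <= dr by rewrite ge_min lexx.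
  have : Num.min dr ds <= ds by rewrite ge_min lexx orbT.
  move=> mds mdr.
  have {}/Hr[Hrp Hrm] : `|disagreement G z r| < dr by lra.
  have {}/Hs[Hsp Hsm] : `|disagreement G z s| < ds by lra.
  rewrite !consensus_fieldE; move: Hrp Hrm Hsp Hsm nz; rewrite disr diss !opprK.
  rewrite !pmulr_rgt0// !pmulr_rlt0// !subr_gt0 !subr_lt0 => Hrp Hrm Hsp Hsm nz.
  have [zz|zz|zz] := ltgtP (z r 0) (z s 0).
  - by left; split; [exact: Hrp|exact: Hsm].
  - by right; split; [exact: Hrm|exact: Hsp].
  - by exfalso; apply: nz; rewrite zz subrr mulr0.
have wr : `|w r 0| <= p.
  apply/ler_addgt0Pr => e e0; have [d [S [d0 S0 H]]] := est e e0.
  apply: (filippov_coord_abs d0 S0 _ Fw) => z xz nS.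
  by case: (H z xz nS) => -[+ _]; rewrite !ler_norml => /andP[? ?]; lra.
pose a j := if j == r then q else if j == s then p else 0.
have sumE (u : 'cV[R]_n) : \sum_j a j * u j 0 = q * u r 0 + p * u s 0.
  rewrite (bigD1 r)//= (bigD1 s)//= /a eqxx (negbTE sr) eqxx big1 ?addr0//.
  by move=> j /andP[/negbTE -> /negbTE ->]; rewrite mul0r.
have : `|q * w r 0 + p * w s 0| <= 0.
  apply/ler_addgt0Pr => e0 e00; rewrite add0r.
  pose e := e0 / (p + q + 1).
  have pq1 : 0 < p + q + 1 by lra.
  have e_gt0 : 0 < e by rewrite divr_gt0.
  have [d [S [d0 S0 H]]] := est e e_gt0.
  rewrite -sumE; apply: (filippov_linform_abs d0 S0 _ Fw) => z xz nS.
  rewrite sumE.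
  have ee : e0 = p * e + q * e + e by rewrite /e; field; rewrite gt_eqF.
  apply: (@le_trans _ _ (p * e + q * e)); last by rewrite ee lerDl ltW.
  case: (H z xz nS) => -[hr hs].
    rewrite (_ : _ + _ = q * (h z r 0 - p) + p * (h z s 0 + q)); last by ring.
    rewrite (le_trans (ler_normD _ _))// !normrM (ger0_norm p0) (ger0_norm q0).
    by rewrite addrC lerD// ler_wpM2l.
  rewrite (_ : _ + _ = q * (h z r 0 + p) + p * (h z s 0 - q)); last by ring.
  rewrite (le_trans (ler_normD _ _))// !normrM (ger0_norm p0) (ger0_norm q0).
  by rewrite addrC lerD// ler_wpM2l.
rewrite -wrs -mulrDl normr_le0 mulf_eq0 => /orP[/eqP pq|/eqP //].
by apply/normr0_eq0/eqP; rewrite eq_le normr_ge0 andbT; lra.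
Qed.

End FieldFacts.

(** * Filippov solutions of the consensus dynamics *)

Section Dynamics.
Context {R : realType} {n : nat}.
Variables (G : wdigraph R n) (f : 'I_n -> R -> R).
Hypothesis f_sign : forall i, sign_preserving (f i).
Hypothesis f_bnd : forall i, locally_ess_bounded (f i).
Local Notation h := (consensus_field G f).
Implicit Types (i j r : 'I_n).

(** The roots are assumed to share one velocity, so it is enough to find one root at
    rest.  Agreement of the roots gives them zero disagreement, where a continuous
    [f_r] forces velocity [0]; a single root has no in-neighbour, hence velocity
    [0]; two roots are each other's only in-neighbours, and [velocity_two_roots]
    applies. *)
Lemma root_at_rest :
  [\/ (cont_nodes f :&: root_nodes G)%SET != finset.set0,
      #|root_nodes G| = 1%N |
      #|root_nodes G| = 2%N /\
      forall i, i \in root_nodes G -> exists lm lp : R,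
        [/\ f i y @[y --> 0^'-] --> lm, f i y @[y --> 0^'+] --> lp &
            lm = - lp]] ->
  (exists r, is_root G r) /\
  forall x w : 'cV[R]_n, (forall r s, is_root G r -> is_root G s ->
                 x r 0 = x s 0 /\ w r 0 = w s 0) ->
    filippov h x w -> forall r, is_root G r -> w r 0 = 0.
Proof.
have rootE r : (r \in root_nodes G) = is_root G r by rewrite inE.
move=> cond.
suff [[r Gr] H] : (exists r, is_root G r) /\ forall x w : 'cV[R]_n,
    (forall r s, is_root G r -> is_root G s -> x r 0 = x s 0 /\ w r 0 = w s 0) ->
    filippov h x w -> exists2 r, is_root G r & w r 0 = 0.
  split; first by exists r.
  move=> x w xw Fw s Gs; have [u Gu <-] := H x w xw Fw.
  by have [] := xw s u Gs Gu.
case: cond.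
- move=> /set0Pn[r]; rewrite inE rootE inE => /andP[/asboolP fr Gr].
  split; first by exists r.
  move=> x w xw Fw; exists r => //; apply: velocity_cont0 Fw => //.
  apply: disagreement_const => j jr.
  by have [] := xw j r (is_root_edge Gr jr) Gr.
- move=> /eqP/cards1P[r rE]; have Gr : is_root G r by rewrite -rootE rE inE.
  split; first by exists r.
  move=> x w xw Fw; exists r => //; apply: velocity_no_in_edge Fw => // j.
  apply/negP => jr; have := is_root_edge Gr jr; rewrite -rootE rE inE => /eqP jE.
  by move: jr; rewrite jE wd_edge_irrefl.
- case=> /eqP/cards2P[r [s [rs rE]]] flim.
  have rootP j : is_root G j = (j == r) || (j == s) by rewrite -rootE rE !inE.
  have Gr : is_root G r by rewrite rootP eqxx.
  have Gs : is_root G s by rewrite rootP eqxx orbT.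
  have edge a b : is_root G a -> is_root G b -> a != b ->
      (forall j, is_root G j -> j = a \/ j = b) -> forall j, wd_edge G j a = (j == b).
    move=> Ga Gb ab abE j; apply/idP/eqP => [ja|->].
      have [jE|//] := abE j (is_root_edge Ga ja).
      by move: ja; rewrite jE wd_edge_irrefl.
    have ba : b != a by rewrite eq_sym.
    have [k ka Gk] := root_in_edge Ga Gb ba.
    have [kE|<-//] := abE k Gk.
    by move: ka; rewrite kE wd_edge_irrefl.
  split; first by exists r.
  move=> x w xw Fw; exists r => //.
  have [lmr [p [fmr fpr lmrE]]] := flim r (etrans (rootE r) Gr).
  have [lms [q [fms fps lmsE]]] := flim s (etrans (rootE s) Gs).
  have [xrs wrs] := xw r s Gr Gs.
  rewrite lmrE in fmr; rewrite lmsE in fms.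
  apply: (velocity_two_roots f_sign rs _ _ fmr fpr fms fps xrs Fw wrs).
    apply: edge => // j; rewrite rootP => /orP[] /eqP ->; [by left|by right].
  apply: edge => //; first by rewrite eq_sym.
  by move=> j; rewrite rootP => /orP[] /eqP ->; [right|left].
Qed.

Hypothesis root_rest : forall x w : 'cV[R]_n,
    (forall r s, is_root G r -> is_root G s -> x r 0 = x s 0 /\ w r 0 = w s 0) ->
    filippov h x w -> forall r, is_root G r -> w r 0 = 0.
Variable (r0 : 'I_n).
Hypothesis r0_root : is_root G r0.

(** If all maximizers are balanced, the set of maximizers is closed under
    in-neighbours.  The factor [b] treats maxima and minima at once. *)
Lemma roots_extremal (b : R) (x : 'cV[R]_n) i : b != 0 ->
  (forall j, b * x j 0 <= b * x i 0) ->
  (forall k, (forall j, b * x j 0 <= b * x k 0) -> disagreement G x k = 0) ->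
  forall r, is_root G r -> forall j, b * x j 0 <= b * x r 0.
Proof.
move=> b0 imax flat r Gr; apply/forallP.
apply: (root_sub_closed (A := fun r => [forall j, b * x j 0 <= b * x r 0]) _ _ Gr);
  last exact/forallP/imax.
move=> k l /forallP kmax lk; apply/forallP => j.
have := @disagreement_max_eq0 _ _ G (b *: x) k _ _ l lk.
rewrite disagreementZ flat// mulr0 !mxE => ->//.
by move=> m; rewrite !mxE.
Qed.

(** All maximizers of [b *: x] share one velocity.  It points against [b] if one of
    them has nonzero disagreement; otherwise the roots are maximizers and at rest. *)
Lemma extremal_velocity (b : R) (x w : 'cV[R]_n) i : b != 0 ->
  (forall j, b * x j 0 <= b * x i 0) ->
  (forall k l, x k 0 = x l 0 -> w k 0 = w l 0) ->
  filippov h x w -> b * w i 0 <= 0.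
Proof.
move=> b0 imax coinc Fw.
have eqmax k : (forall j, b * x j 0 <= b * x k 0) -> x i 0 = x k 0.
  by move=> kmax; apply: (mulfI b0); apply/le_anti; rewrite kmax imax.
have [flat|] := pselect (forall k, (forall j, b * x j 0 <= b * x k 0) ->
    disagreement G x k = 0).
  have rmax := roots_extremal b0 imax flat.
  rewrite (coinc i r0); last exact/eqmax/rmax.
  rewrite (@root_rest x w) ?mulr0// => r s Gr Gs.
  have rs : x r 0 = x s 0 by rewrite -(eqmax r (rmax r Gr)) (eqmax s (rmax s Gs)).
  by split => //; exact: coinc.
move=> /existsNP[k /not_implyP[kmax /eqP dk]].
have [kappa [rho [kappa0 rho0 H]]] := velocity_push G f_sign k dk.
have := H x w; rewrite subrr normr0 => /(_ rho0 Fw) Hk.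
rewrite (coinc i k (eqmax k kmax)).
have : b * disagreement G x k <= 0.
  by rewrite -disagreementZ disagreement_max_le0// => j; rewrite !mxE.
have [dn|dp|] := ltgtP (disagreement G x k) 0; last by move/eqP: dk.
- move: Hk; rewrite ltr0_sg// mulN1r nmulr_lle0// => Hk bk.
  by rewrite mulr_ge0_le0//; lra.
- move: Hk; rewrite gtr0_sg// mul1r pmulr_lle0// => Hk bk.
  by rewrite mulr_le0_ge0//; lra.
Qed.

Section Solution.
Variable (x : R -> 'cV[R]_n).
Hypothesis x_sol : is_solution (filippov h) +oo%E x.

Lemma solution_ac s t : 0 <= s -> s <= t -> abs_continuous_on x s t.
Proof.
move=> s0 st; have [ac _] := x_sol.
by apply: abs_continuous_subinterval (ac t (le_trans s0 st) (ltry _)).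
Qed.

Lemma solution_ae : {ae lebesgue_measure, forall t, 0 <= t -> exists w,
  [/\ straddle_deriv x t w, filippov h (x t) w &
      forall k l, x t k 0 = x t l 0 -> w k 0 = w l 0]}.
Proof.
have [_ xae] := x_sol.
apply: lebesgue_aeS (lebesgue_aeI xae (coincident_derivatives x)).
move=> t [H C] t0; have [/derivable_straddle xw Fw] := H t0 (ltry _).
by exists ('D_1 x t); split => // k l; exact: C.
Qed.

Lemma solution_cmax (b : R) i0 s t : b != 0 -> 0 <= s -> s <= t ->
  cmax i0 (b *: x t) <= cmax i0 (b *: x s).
Proof.
move=> b0 s0 st; apply: (@cmax_nonincreasing _ _ i0 (fun u => b *: x u) s t st).
  by apply: abs_continuousZ; exact: solution_ac.
apply: lebesgue_aeS solution_ae => r H /andP[sr _].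
have [w [xw Fw cw]] := H (le_trans s0 sr).
exists (b *: w); first exact: straddle_derivZ.
move=> i imax; rewrite mxE; apply: extremal_velocity Fw => // j.
by have := imax j; rewrite !mxE.
Qed.

Lemma solution_within t i : 0 <= t ->
  exists j k, x 0 j 0 <= x t i 0 <= x 0 k 0.
Proof.
move=> t0.
have N10 : -1 != 0 :> R by rewrite oppr_eq0 oner_eq0.
have := solution_cmax i N10 (lexx 0) t0.
have := solution_cmax i (oner_neq0 R) (lexx 0) t0.
have [k ->] := cmax_attained i (1 *: x 0).
have [j ->] := cmax_attained i (-1 *: x 0).
have := cmax_ge i (1 *: x t) i; have := cmax_ge i (-1 *: x t) i.
by rewrite !mxE !mul1r !mulN1r => ? ? ? ?; exists j, k; apply/andP; split; lra.
Qed.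

Lemma solution_bounded : exists N, forall t, 0 <= t -> forall i, `|x t i 0| <= N.
Proof.
exists `|x 0| => t t0 i; have [j [k /andP[jx xk]]] := solution_within i t0.
have := ler_coord (x 0) j; have := ler_coord (x 0) k.
by rewrite !ler_norml => /andP[? ?] /andP[? ?]; apply/andP; split; lra.
Qed.

Lemma solution_lipschitz : exists2 B, 0 < B & forall s t i, 0 <= s -> s <= t ->
  `|x t i 0 - x s i 0| <= B * (t - s).
Proof.
have [N xN] := solution_bounded.
have [B B0 HB] := velocity_bounded G f_sign f_bnd N.
exists B => // s t i s0 st.
have slope b : `|b| = 1 -> b * x t i 0 - b * x s i 0 <= B * (t - s).
  move=> b1; apply: coord_slope => //; first exact: solution_ac.
  apply: lebesgue_aeS solution_ae => r H /andP[sr _].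
  have r0' := le_trans s0 sr; have [w [xw Fw _]] := H r0'.
  exists w => //; apply: (le_trans (ler_norm _)).
  by rewrite normrM b1 mul1r (HB (x r))//; exact: xN.
have := slope 1 (normr1 _); have := slope (-1).
rewrite normrN1 !mul1r !mulN1r => /(_ erefl) ? ?.
by rewrite ler_norml; apply/andP; split; lra.
Qed.

(** Suppose that [i] is a maximizer of [b *: p] with nonzero disagreement, which
    then has the sign of [- b].  While the solution stays within [r] of [p], the
    coordinate [b * x_i] decreases at rate [kappa]; by the Lipschitz bound, the
    solution stays there for the time [tau] preceding any visit to the
    [e]-neighbourhood of [p].  Thus [b * x_i] was above [b * p_i + kappa * tau - e]
    at the beginning, whereas the maximum of [b *: x], being nonincreasing, was
    already at most [b * p_i + e]. *)
Lemma cluster_extremum_balanced (p : 'cV[R]_n) (b : R) i :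
  (forall e T, 0 < e -> exists2 t, T <= t & forall j, `|x t j 0 - p j 0| < e) ->
  `|b| = 1 -> (forall j, b * p j 0 <= b * p i 0) -> disagreement G p i = 0.
Proof.
move=> clp b1 imax; apply: contrapT => /eqP dp.
have b0 : b != 0 by rewrite -normr_eq0 b1 oner_eq0.
have [kappa [rho [kappa0 rho0 Hpush]]] := velocity_push G f_sign i dp.
have sgE : Num.sg (disagreement G p i) = - b.
  have bp : b * disagreement G p i <= 0.
    by rewrite -disagreementZ disagreement_max_le0// => j; rewrite !mxE.
  have [dn|dp0|dp0] := ltgtP (disagreement G p i) 0; last by rewrite dp0 eqxx in dp.
    move: bp; rewrite nmulr_lle0// => bp; rewrite ltr0_sg//.
    by move: b1; rewrite ger0_norm// => ->.
  move: bp; rewrite pmulr_lle0// => bp; rewrite gtr0_sg//.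
  by move: b1; rewrite ler0_norm// => ->.
have [C C0 HC] := disagreement_lip G.
have [B B0 HB] := solution_lipschitz.
pose r := rho / 2 / C.
have r_gt0 : 0 < r by rewrite !divr_gt0.
pose tau := r / 2 / B.
have tau0 : 0 < tau by rewrite !divr_gt0.
have Btau : B * tau = r / 2 by rewrite /tau mulrCA mulfV ?gt_eqF// mulr1.
pose e := Num.min (r / 2) (kappa * tau / 4).
have e0 : 0 < e by rewrite lt_min !divr_gt0// mulr_gt0.
have er : e <= r / 2 by rewrite ge_min lexx.
have ek : e <= kappa * tau / 4 by rewrite ge_min lexx orbT.
(* An early visit at [T] bounds the maximum ever after; the visit at [t] is late
   enough for the interval [[t - tau, t]] to lie beyond [T]. *)
have [T T0 clT] := clp e 0 e0.
have [t Tt clt] := clp e (T + tau) e0.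
pose s := t - tau.
have s0 : 0 <= s by rewrite /s; lra.
have st : s <= t by rewrite /s; lra.
have Ts : T <= s by rewrite /s; lra.
have near_p u j : s <= u -> u <= t -> `|x u j 0 - p j 0| <= r.
  move=> su ut; have := HB u t j (le_trans s0 su) ut.
  have : B * (t - u) <= B * tau by rewrite ler_pM2l//; rewrite /s in su; lra.
  have := clt j; rewrite Btau => /ltW.
  rewrite !ler_norml => /andP[? ?] ? /andP[? ?].
  by apply/andP; split; lra.
have slope : b * x t i 0 - b * x s i 0 <= - kappa * (t - s).
  apply: coord_slope => //; first exact: solution_ac.
  apply: lebesgue_aeS solution_ae => u H /andP[su ut].
  have [w [xw Fw _]] := H (le_trans s0 su).
  exists w => //; rewrite lerNr -mulNr -sgE; apply: Hpush Fw.
  have := HC _ _ i _ (fun j => near_p u j su ut).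
  by rewrite /r mulrCA mulfV ?gt_eqF// mulr1; lra.
have tsE : t - s = tau by rewrite /s; lra.
have : b * x s i 0 <= cmax i (b *: x s).
  by have := cmax_ge i (b *: x s) i; rewrite mxE.
have := solution_cmax i b0 T0 Ts.
have : cmax i (b *: x T) <= b * p i 0 + e.
  have [j ->] := cmax_attained i (b *: x T); rewrite mxE.
  have : `|b * x T j 0 - b * p j 0| < e by rewrite -mulrBr normrM b1 mul1r.
  by rewrite ltr_norml => /andP[_]; have := imax j; lra.
have : `|b * x t i 0 - b * p i 0| < e by rewrite -mulrBr normrM b1 mul1r.
move: slope; rewrite tsE ltr_norml => slope /andP[? ?] ? ? ?.
by lra.
Qed.

(** Every root is both a maximizer and a minimizer of a cluster point [p], so [p] is
    constant.  The extreme coordinates of the solution are monotone, so they stay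
    within [e] of this constant after the first visit. *)
Lemma solution_consensus : exists eta : R,
  x t @[t --> +oo] --> (const_mx eta : 'cV[R]_n).
Proof.
have [N xN] := solution_bounded.
have [p clp] := bounded_cluster xN.
have rext b : `|b| = 1 -> forall j, b * p j 0 <= b * p r0 0.
  move=> b1; have b0 : b != 0 by rewrite -normr_eq0 b1 oner_eq0.
  have [i pi] := cmax_attained r0 (b *: p).
  apply: (@roots_extremal b p i) => // [j|k]; last exact: cluster_extremum_balanced.
  by have := cmax_ge r0 (b *: p) j; rewrite pi !mxE.
have pE j : p j 0 = p r0 0.
  have := rext 1 (normr1 _) j; have := rext (-1) _ j.
  rewrite normrN1 !mul1r !mulN1r => /(_ erefl); lra.
exists (p r0 0); apply/cvgrPdist_lt => e e0.
have [T T0 clT] := clp e 0 e0.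
exists T; split; first exact: num_real.
move=> t /ltW Tt.
rewrite [ltLHS]/Num.norm /= mx_normrE; apply: bigmax_lt => // -[j k] _ /=.
rewrite !mxE ord1 distrC.
have close b : `|b| = 1 -> b * x t j 0 - b * p r0 0 < e.
  move=> b1; have b0 : b != 0 by rewrite -normr_eq0 b1 oner_eq0.
  have := solution_cmax r0 b0 T0 Tt; have := cmax_ge r0 (b *: x t) j.
  have [l ->] := cmax_attained r0 (b *: x T); rewrite !mxE.
  have : `|b * x T l 0 - b * p l 0| < e by rewrite -mulrBr normrM b1 mul1r.
  by rewrite pE ltr_norml => /andP[_]; lra.
have := close 1 (normr1 _); have := close (-1).
rewrite normrN1 !mul1r !mulN1r => /(_ erefl) ? ?.
by rewrite ltr_norml; apply/andP; split; lra.
Qed.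
End Solution.
End Dynamics.

Theorem theorem7 (R : realType) (n : nat) (G : wdigraph R n)
    (f : 'I_n -> R -> R)
    (f_sign : forall i, sign_preserving (f i))
    (f_meas : forall i, lebesgue_measurable (f i))
    (f_bnd : forall i, locally_ess_bounded (f i))
    (f_complete : complete_inclusion (filippov (consensus_field G f)))
    (f_cond :
       [\/ (cont_nodes f :&: root_nodes G)%SET != finset.set0,
           #|root_nodes G| = 1%N |
           #|root_nodes G| = 2%N /\
           forall i, i \in root_nodes G -> exists lm lp : R,
             [/\ f i y @[y --> 0^'-] --> lm, f i y @[y --> 0^'+] --> lp &
                 lm = - lp]]) :
  forall x : R -> 'cV[R]_n,
    is_solution (filippov (consensus_field G f)) +oo%E x ->
    (exists eta : R, x t @[t --> +oo] --> (const_mx eta : 'cV[R]_n)) /\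
    (forall t : R, 0 <= t -> forall i : 'I_n,
       \big[Num.min/x 0 i 0]_j x 0 j 0 <= x t i 0
         <= \big[Num.max/x 0 i 0]_j x 0 j 0).
Proof.
move=> x x_sol; have [[r Gr] root_rest] := root_at_rest f_sign f_cond.
split; first exact: (solution_consensus f_sign f_bnd root_rest Gr x_sol).
move=> t t0 i.
have [j [k /andP[jx xk]]] := solution_within f_sign root_rest Gr x_sol i t0.
apply/andP; split.
  exact: le_trans (bigmin_le_cond _ (fun j => x 0 j 0) isT) jx.
exact: le_trans xk (le_bigmax _ (fun j => x 0 j 0) k).
Qed.
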